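(* Let $n\ge1$, $k>0$, $1\le j\le n+1$, let $f:\mathbb{R}\to\mathbb{R}$ be smooth and define $F(\lambda_1,\dots,\lambda_{n+1})=f(\lambda_j)$. Then for every $\lambda\in\mathbb{R}^{n+1}$, $$V_k(F)(\lambda)=c_{n,k}\int_\sigma f(\lambda_1t_1+\dots+\lambda_{n+1}t_{n+1})\,t_j\,(t_1\cdots t_{n+1})^{k-1}\,dt.$$
   Context: Root system $A_n$ on $\mathbb{R}^{n+1}$ (no normalization $\sum x_i=0$), constant multiplicity $k>0$, Dunkl operators $T_jf(\lambda)=\partial_{\lambda_j}f(\lambda)+k\sum_{i\neq j}\frac{f(\lambda)-f((i,j)\lambda)}{\lambda_j-\lambda_i}$. The intertwining operator $V_k$ is the unique linear operator on polynomials with $T_jV_k=V_k\partial_j$, preserving homogeneous polynomials of each degree, with $V_k1=1$; it is given by $V_kf(\lambda)=\int f\,d\mu_\lambda$ for a compactly supported positive probability measure $\mu_\lambda$, which defines $V_k$ on smooth functions. $c_{n,k}=\frac{(n+1)\Gamma((n+1)k)}{\Gamma(k)^{n+1}}$, $\sigma=\{(t_1,\dots,t_{n+1}):t_p\ge0,\ \sum_pt_p=1\}$, $dt=dt_1\cdots dt_n$ with $t_{n+1}=1-t_1-\dots-t_n$. *)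

(* Defs.v *)
From HB Require Import structures.
From mathcomp Require Import all_boot all_order all_algebra.
From mathcomp Require Import all_classical all_reals all_analysis.
From mathcomp Require mpoly.

Set Implicit Arguments.
Unset Strict Implicit.
Unset Printing Implicit Defensive.
Import Order.TTheory GRing.Theory Num.Theory.
Local Open Scope classical_set_scope.
Local Open Scope ring_scope.

Definition smooth (R : realType) (f : R -> R) : Prop :=
  forall (m : nat) (x : R), derivable (derive1n m f) x 1.

Definition Gamma (R : realType) (x : R) : R :=
  fine (\int[@lebesgue_measure R]_(t in `]0, +oo[%classic)
          (powR t (x - 1) * expR (- t))%:E).

Definition c_nk (R : realType) (n : nat) (k : R) : R :=
  (n.+1)%:R * Gamma ((n.+1)%:R * k) / Gamma k ^+ n.+1.

Definition swap_pt (R : Type) (N : nat) (i j : 'I_N) (l : 'I_N -> R) : 'I_N -> R :=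
  fun p => if p == i then l j else if p == j then l i else l p.

Definition dunkl (R : realType) (N : nat) (k : R) (j : 'I_N)
    (q : mpoly.mpoly N R) (l : 'I_N -> R) : R :=
  mpoly.meval l (mpoly.mderiv j q)
  + k * \sum_(i < N | i != j)
          (mpoly.meval l q - mpoly.meval (swap_pt i j l) q) / (l j - l i).

(* p is a homogeneous polynomial of degree m: every monomial in its support
   has total degree m (this is mpoly's  p \is m.-homog  unfolded) *)
Definition homog_deg (R : ringType) (N m : nat) (p : mpoly.mpoly N R) : bool :=
  all [pred mm | mpoly.mdeg mm == m] (mpoly.msupp p).

(* Points of R^N are N-tuples (with the product sigma-algebra). *)

(* [mu] is a family of representing measures of the intertwining operator V_k
   on R^(n+1): each mu l is a compactly supported probability measure, and the
   operator V p (l) := int p d(mu l) on polynomials preserves homogeneous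
   polynomials of each degree and satisfies T_j V = V d_j
   (V 1 = 1 holds since the mu l are probability measures). *)
Definition Vk_measures (R : realType) (n : nat) (k : R)
    (mu : (n.+1).-tuple R -> probability ((n.+1).-tuple R) R) : Prop :=
  (forall l, exists r : R, mu l [set x | exists i, r < `|tnth x i|] = 0%E)
  /\
  (forall (m : nat) (p : mpoly.mpoly n.+1 R),
      homog_deg m p ->
      exists q : mpoly.mpoly n.+1 R,
        homog_deg m q /\
        forall l, (\int[mu l]_x (mpoly.meval (tnth x) p)%:E
                   = (mpoly.meval (tnth l) q)%:E)%E)
  /\
  (* intertwining: T_j (V p) = V (d_j p), checked at points with pairwise
     distinct coordinates (both sides are polynomials) *)
  (forall (p q : mpoly.mpoly n.+1 R),
      (forall l, (\int[mu l]_x (mpoly.meval (tnth x) p)%:E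
                 = (mpoly.meval (tnth l) q)%:E)%E) ->
      forall (j : 'I_n.+1) (l : (n.+1).-tuple R), injective (tnth l) ->
        (\int[mu l]_x (mpoly.meval (tnth x) (mpoly.mderiv j p))%:E
         = (dunkl k j q (tnth l))%:E)%E).

Fixpoint iint (R : realType) (m : nat) : (m.-tuple R -> \bar R) -> \bar R :=
  match m with
  | 0 => fun g => g [tuple]
  | m'.+1 => fun g =>
      (\int[@lebesgue_measure R]_x iint (fun t => g (cons_tuple x t)))%E
  end.

Definition simplex_pt (R : realType) (n : nat) (s : n.-tuple R) : 'I_n.+1 -> R :=
  fun p => if (p < n)%N then nth 0 s p else 1 - \sum_(i < n) tnth s i.

Definition simplex_integral (R : realType) (n : nat) (g : ('I_n.+1 -> R) -> R)
  : \bar R :=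
  iint (fun s : n.-tuple R =>
          if [forall p, 0 <= simplex_pt s p] then (g (simplex_pt s))%:E
          else 0%E).

(* Main.v *)
(* Both sides are positive functionals of f with compact support, so by Bernstein
   approximation it suffices to take f = x^m.  The Dirichlet moments
   M_m(a) = \int (l . t)^m \prod t_p^(a_p - 1) satisfy
     (m + |a|) M_m(a + e_j) = a_j M_m(a) + m l_j M_(m-1)(a + e_j),
   and taking a = (k, ..., k) this says that P_m = c_(n,k) M_m(a + e_j) solves
     m P_m + (k / 2) \sum_(i, p) (P_m - P_m o (i p)) = m l_j P_(m-1).
   The polynomial V_k(x_j^m) solves the same recursion: multiply
   T_i V_k(x_j^m) = V_k(d_i x_j^m) by l_i and sum over i, using Euler's identity.
   Since k > 0, the maximum principle on orbits of the symmetric group shows that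
   the solution is unique. *)
Require Import Defs.
From HB Require Import structures.
From mathcomp Require Import all_boot all_order all_algebra.
From mathcomp Require Import fingroup perm.
From mathcomp Require Import all_classical all_reals all_analysis.
From mathcomp Require Import measurable_realfun ring lra.
From mathcomp Require mpoly.
Import Order.TTheory GRing.Theory Num.Theory.
Local Open Scope ring_scope.

(** * Euler integrals *)

Section EulerIntegrals.
Set Implicit Arguments.
Unset Strict Implicit.
Import numFieldNormedType.Exports.
Local Open Scope classical_set_scope.
Local Open Scope ereal_scope.

(** Two obstacles shape the proof. The Dunkl operator divides by differences of coordinates, so the
    intertwining relation is exploited only at points with distinct coordinates; permutations
    preserve such points, so the maximum principle stays among them, and the identity reaches the
    other points because both sides are polynomials in [l]. The simplex integral is an iterated
    integral in the extended reals, so linearity has to be paid for with absolute finiteness. To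
    keep the two apart, the moments M_m(a) are defined algebraically from Gamma values. Their
    recursion then follows from Gamma(s + 1) = s Gamma(s), without integration by parts, and the
    Dirichlet integral is the bridge to integration. The term a_j M_m(a) turns into a sum over
    reflections for two reasons: \sum_p t_p = 1 gives M_m(a) = \sum_p M_m(a + e_p), and for constant
    a a transposition (i p) merely moves the marked index j. The value of c_(n,k) is fixed by the
    case m = 0, where the recursion says nothing. *)

Lemma ge0_integral_affine (R : realType) (c d : R) (f : R -> \bar R) :
  (0 < c)%R -> measurable_fun [set: R] f -> (forall x, 0 <= f x) ->
  \int[@lebesgue_measure R]_x f x =
  c%:E * \int[@lebesgue_measure R]_x f (c * x + d)%R.
Proof.
move=> c0 mf f0.
pose phi : R -> measurableTypeR R := fun x => (c * x + d)%R.
have mphi : measurable_fun [set: R] phi.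
  by apply: measurable_funD => //; exact: measurable_funM.
pose k : {nonneg R} := NngNum (ltW c0).
have E A : measurable A -> A `<=` setT ->
    @lebesgue_measure R A = mscale k (pushforward (@lebesgue_measure R) phi) A.
  move=> mA _; apply: lebesgue_measure_unique => //= _ [[a b]] _ <-.
  rewrite /mscale /= /pushforward.
  have -> : phi @^-1` `]a, b]%classic = `]((a - d) / c)%R, ((b - d) / c)%R]%classic.
    apply/seteqP; split=> x /=; rewrite !in_itv/= /phi.
      by rewrite ltr_pdivrMr// ler_pdivlMr// ltrBlDr lerBrDr mulrC.
    by rewrite ltr_pdivrMr// ler_pdivlMr// ltrBlDr lerBrDr mulrC.
  rewrite !lebesgue_measure_itv/= !lte_fin ltr_pM2r ?invr_gt0// ltrD2r.
  case: ifP => ab; last by rewrite mule0.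
  rewrite -!EFinD -EFinM; congr (_%:E).
  by field; rewrite gt_eqF.
rewrite (eq_measure_integral _ (E mphi)) ge0_integral_mscale//.
by rewrite ge0_integral_pushforward// => x _; exact: f0.
Qed.

(* The closed support matters: products of [pw] agree with the integrand of
   [simplex_integral] everywhere, including the boundary of the simplex, where
   [0 `^ 0 = 1]. *)
Definition pw (R : realType) (a x : R) : R :=
  if (0 <= x)%R then (x `^ (a - 1))%R else 0%R.

Lemma pw_ge0 (R : realType) (a x : R) : (0 <= pw a x)%R.
Proof. by rewrite /pw; case: ifP => // _; exact: powR_ge0. Qed.

Lemma pw_lt0 (R : realType) (a x : R) : (x < 0)%R -> pw a x = 0%R.
Proof. by rewrite /pw => x0; rewrite leNgt x0. Qed.

Lemma pw1 (R : realType) (x : R) : pw 1 x = ((0 <= x)%R%:R)%R.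
Proof. by rewrite /pw subrr powRr0; case: ifP. Qed.

Lemma pw_mul (R : realType) (a c x : R) : (0 < c)%R ->
  pw a (c * x) = (c `^ (a - 1) * pw a x)%R.
Proof.
move=> c0; rewrite /pw pmulr_rge0//; case: ifPn => x0; last by rewrite mulr0.
by rewrite powRM// ltW.
Qed.

Lemma mul_pw (R : realType) (a x : R) : (0 < a)%R -> (x * pw a x = pw (a + 1) x)%R.
Proof.
move=> a0; rewrite /pw; case: ifPn => x0; last by rewrite mulr0.
rewrite addrK; have [->|xn0] := eqVneq x 0%R; first by rewrite mul0r powR0// gt_eqF.
by rewrite mulr_powRB1.
Qed.

Lemma measurable_pw (R : realType) (a : R) : measurable_fun [set: R] (pw a).
Proof.
apply: measurable_fun_ifT => //.
exact: measurable_fun_ler.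
Qed.

(** Kept in the extended reals so that the Tonelli identities below can be stated before convergence
    is known. *)
Definition eGamma (R : realType) (a : R) : \bar R :=
  \int[@lebesgue_measure R]_x (pw a x * expR (- x))%:E.

(** A convolution of two powers supported on the half-line; at [s = 1] it is Euler's beta
    integral. *)
Definition conv_pw (R : realType) (a b s : R) : \bar R :=
  \int[@lebesgue_measure R]_x (pw a x * pw b (s - x))%:E.

Lemma measurable_expN (R : realType) : measurable_fun [set: R] (fun x : R => expR (- x)).
Proof. exact: measurableT_comp. Qed.

Lemma measurable_conv_pw (R : realType) (a b : R) :
  measurable_fun [set: R * R] (fun z => pw a z.1 * pw b (z.2 - z.1))%R.
Proof.
apply: measurable_funM; apply: measurableT_comp => //; try exact: measurable_pw.
exact: measurable_funB.
Qed.

Lemma measurable_conv_pw_l (R : realType) (a b s : R) :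
  measurable_fun [set: R] (fun x => (pw a x * pw b (s - x))%:E).
Proof.
apply/measurable_EFinP/measurable_funM; first exact: measurable_pw.
apply: measurableT_comp; first exact: measurable_pw.
exact: measurable_funB.
Qed.

Lemma conv_pw_lt0 (R : realType) (a b s : R) : (s < 0)%R -> conv_pw a b s = 0.
Proof.
move=> s0; rewrite /conv_pw integral0_eq// => x _.
have [x0|x0] := ltP x 0%R; first by rewrite pw_lt0// mul0r.
by rewrite (@pw_lt0 _ b) ?mulr0// subr_lt0 (lt_le_trans s0).
Qed.

(** The substitution x = s u produces s * s^(a-1) * s^(b-1). The identity can fail at s = 0: if a +
    b = 1 then [pw (a + b) 0] is 1, while the convolution there is 0. Later uses discard that null
    point. *)
Lemma conv_pw_scale (R : realType) (a b s : R) : (0 < s)%R ->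
  conv_pw a b s = (pw (a + b) s)%:E * conv_pw a b 1.
Proof.
move=> s0; rewrite /conv_pw.
have f0 x : 0 <= (pw a x * pw b (s - x))%:E by rewrite lee_fin mulr_ge0// pw_ge0.
rewrite [LHS](@ge0_integral_affine R s 0 _ s0 (measurable_conv_pw_l a b s) f0).
under eq_integral.
  move=> x _; rewrite addr0 pw_mul// (_ : s - s * x = s * (1 - x))%R; last by ring.
  rewrite pw_mul// mulrACA EFinM; over.
rewrite /= ge0_integralZl_EFin//.
- rewrite muleA -EFinM; congr (_%:E * _).
  rewrite [pw _ s]/pw (ltW s0) (_ : a + b - 1 = 1 + ((a - 1) + (b - 1)))%R; last by ring.
  have sD x y : (s `^ (x + y) = s `^ x * s `^ y)%R by rewrite powRD ?(gt_eqF s0) ?implybT.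
  by rewrite (sD 1%R) (sD (a - 1)%R) powRr1 ?mulrA// ltW.
- by move=> x _; rewrite lee_fin mulr_ge0// pw_ge0.
- exact: measurable_conv_pw_l.
- by rewrite mulr_ge0// powR_ge0.
Qed.

Lemma ae_except_point (R : realType) (s : R) (P : R -> Prop) :
  (forall x, x != s -> P x) -> {ae @lebesgue_measure R, forall x, P x}.
Proof.
move=> Ps; exists [set s]; split => //; first exact: lebesgue_measure_set1.
by move=> x /= nP; apply: contrapT => /eqP xs; exact/nP/Ps.
Qed.

(* Substitute y = s - x in the double integral and integrate over x first. *)
Lemma eGamma_mul (R : realType) (a b : R) :
  eGamma a * eGamma b = conv_pw a b 1 * eGamma (a + b).
Proof.
have mE c : measurable_fun [set: R] (fun x : R => (pw c x * expR (- x))%:E).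
  by apply/measurable_EFinP/measurable_funM; [exact: measurable_pw|exact: measurable_expN].
have E0 c (x : R) : 0 <= (pw c x * expR (- x))%:E.
  by rewrite lee_fin mulr_ge0// ?pw_ge0 ?expR_ge0.
have m2 : measurable_fun [set: R * R]
    (fun z : R * R => (pw a z.1 * pw b (z.2 - z.1) * expR (- z.2))%:E).
  apply/measurable_EFinP/measurable_funM; first exact: measurable_conv_pw.
  by apply: measurableT_comp => //; apply: measurableT_comp => //; exact: measurable_snd.
rewrite {1}/eGamma -ge0_integralZr ?integral_ge0//.
transitivity (\int[@lebesgue_measure R]_x \int[@lebesgue_measure R]_s
     (fun z : R * R => (pw a z.1 * pw b (z.2 - z.1) * expR (- z.2))%:E) (x, s)).
  apply: eq_integral => x _; rewrite /eGamma (@ge0_integral_affine _ 1 (- x))// mul1e.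
  rewrite -ge0_integralZl//.
  - apply: eq_integral => s _ /=; rewrite -EFinM mul1r.
    congr (_%:E); rewrite (_ : - (s - x) = - s + x)%R; last by ring.
    rewrite expRD (expRN x); field.
    by rewrite gt_eqF// expR_gt0.
  - have m1 : measurable_fun [set: R] (fun s : R => 1 * s - x)%R.
      by apply: measurable_funB => //; exact: measurable_funM.
    exact: (measurableT_comp (mE b) m1).
have h0 z : 0 <= (pw a z.1 * pw b (z.2 - z.1) * expR (- z.2))%:E.
  by rewrite lee_fin !mulr_ge0// ?pw_ge0 ?expR_ge0.
rewrite [LHS](fubini_tonelli (m1 := @lebesgue_measure R) (m2 := @lebesgue_measure R) _ m2)//.
have conv0 s : 0 <= conv_pw a b s.
  by apply: integral_ge0 => x _; rewrite lee_fin mulr_ge0// pw_ge0.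
rewrite /= /eGamma -ge0_integralZl//.
have Eg s : \int[@lebesgue_measure R]_x (pw a x * pw b (s - x) * expR (- s))%:E
    = conv_pw a b s * (expR (- s))%:E.
  under eq_integral do rewrite EFinM.
  rewrite ge0_integralZr ?lee_fin ?expR_ge0//; first exact: measurable_conv_pw_l.
  by move=> x _; rewrite lee_fin mulr_ge0// pw_ge0.
apply: ge0_ae_eq_integral => //.
- exact: (measurable_fun_fubini_tonelli_G (m1 := @lebesgue_measure R) _ m2 h0).
- exact: (measurable_funeM _ (mE _)).
- by move=> s _; rewrite Eg mule_ge0.
- by move=> s _; rewrite mule_ge0.
apply: (@ae_except_point R 0%R) => s s0 _.
rewrite Eg; have [sl|sl|s00] := ltgtP s 0%R; last by rewrite s00 eqxx in s0.
- by rewrite conv_pw_lt0// (pw_lt0 _ sl) mul0r mul0e mule0.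
- by rewrite conv_pw_scale// EFinM muleAC muleC.
all: exact: mE.
Qed.

Lemma eGamma_ge0 (R : realType) (a : R) : 0 <= eGamma a.
Proof. by apply: integral_ge0 => x _; rewrite lee_fin mulr_ge0 ?pw_ge0 ?expR_ge0. Qed.

Lemma measurable_eGamma (R : realType) (a : R) :
  measurable_fun [set: R] (fun x : R => (pw a x * expR (- x))%:E).
Proof.
by apply/measurable_EFinP/measurable_funM; [exact: measurable_pw|exact: measurable_expN].
Qed.

Lemma eGamma1 (R : realType) : @eGamma R 1 = 1.
Proof.
rewrite /eGamma -(@integral_exponential_pdf R 1)//.
apply: eq_integral => x _; rewrite pw1 /exponential_pdf patchE; congr (_%:E).
case: ifPn; rewrite ?inE/= ?notin_setE/= in_itv/= andbT.
  by move=> ->; rewrite !mul1r mulN1r.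
by move=> /negP/negbTE ->; rewrite mul0r.
Qed.

(** Cutting at [e] avoids the singularity at 0 present for a < 1, so that the fundamental theorem of
    calculus applies. *)
Lemma integral_pw01_trunc (R : realType) (a e : R) : (0 < a)%R -> (0 < e < 1)%R ->
  \int[@lebesgue_measure R]_(x in `[e, 1%R]) (pw a x)%:E = (a^-1 - a^-1 * e `^ a)%R%:E.
Proof.
move=> a0 /andP[e0 e1].
have dF (x : R) : (0 < x)%R -> is_derive x (1:R)%R (fun y => a^-1 * y `^ a)%R (x `^ (a - 1))%R.
  move=> x0; have := is_deriveZ a^-1 (is_derive1_powR a x0).
  by rewrite /GRing.scale/= mulrA mulVf ?mul1r// gt_eqF.
have cF (x : R) : (0 < x)%R -> {for x, continuous (fun y => a^-1 * y `^ a)%R}.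
  move=> x0; apply: differentiable_continuous; apply/derivable1_diffP.
  by have [] := dF x x0.
transitivity (\int[@lebesgue_measure R]_(x in `[e, 1%R]) (x `^ (a - 1))%:E).
  apply: eq_integral => x; rewrite inE/= in_itv/= => /andP[ex _].
  by rewrite /pw (ltW (lt_le_trans e0 ex)).
rewrite (@continuous_FTC2 _ _ (fun y => a^-1 * y `^ a)%R)//.
- by rewrite powR1 mulr1 EFinB.
- apply: continuous_in_subspaceT => x; rewrite inE/= in_itv/= => /andP[ex _].
  apply: differentiable_continuous; apply/derivable1_diffP.
  by apply: derivable_powR; rewrite in_itv/= andbT (lt_le_trans e0 ex).
- split=> [x||].
  + by rewrite in_itv/= => /andP[ex _]; have [] := dF x (lt_trans e0 ex).
  + by apply: cvg_at_right_filter; exact: cF.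
  + by apply: cvg_at_left_filter; exact: cF.
- move=> x; rewrite in_itv/= => /andP[ex _].
  by rewrite derive1E; have [_ ->] := dF x (lt_trans e0 ex).
Qed.

Lemma conv_pw1r (R : realType) (a : R) : (0 < a)%R -> conv_pw a 1 1 = (a^-1)%:E.
Proof.
move=> a0.
(* An exhaustion of ]0, 1] for monotone convergence; starting at 1/2 keeps the lower end strictly
   below 1, as the truncated integral requires. *)
pose F n : set R := `[(n.+2%:R^-1)%R, 1%R]%classic.
have e01 n : (0 < (n.+2%:R : R)^-1 < 1)%R by rewrite invr_gt0 ltr0n/= invf_lt1 ?ltr1n.
have UF : \bigcup_n F n = `]0%R, 1%R]%classic.
  apply/seteqP; split=> [x [n _]|x]; rewrite /F/= !in_itv/= => /andP[x0 x1].
    by rewrite x1 (lt_le_trans _ x0)//; case/andP: (e01 n).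
  have [n] := ltr_add_invr (ltac:(by rewrite addr0) : (0 < x + 0)%R).
  rewrite add0r addr0 => nx; exists n => //=; rewrite in_itv/= x1 andbT.
  rewrite (le_trans _ (ltW nx))// lef_pV2 ?posrE ?ltr0n// ler_nat//.
have -> : conv_pw a 1 1 = \int[@lebesgue_measure R]_(x in `]0%R, 1%R]) (pw a x)%:E.
  rewrite integral_itv_obnd_cbnd; last first.
    apply: measurable_funTS; apply/measurable_EFinP; exact: measurable_pw.
  rewrite integral_mkcond; apply: eq_integral => x _.
  rewrite patchE pw1 subr_ge0; case: ifPn; rewrite ?inE/= ?notin_setE/= in_itv/=.
    by move=> /andP[_ ->]; rewrite mulr1.
  move=> /negP; rewrite negb_and -ltNge => /orP[x0|/negbTE ->]; last by rewrite mulr0.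
  by rewrite pw_lt0// mul0r.
have cv : (\int[@lebesgue_measure R]_(x in F n) (pw a x)%:E) @[n --> \oo] -->
    \int[@lebesgue_measure R]_(x in \bigcup_n F n) (pw a x)%:E.
  apply: ge0_nondecreasing_set_cvg_integral => //.
  - move=> m n mn; rewrite subsetEset => x; rewrite /F/= !in_itv/= => /andP[mx ->].
    by rewrite andbT (le_trans _ mx)// lef_pV2 ?posrE ?ltr0n// ler_nat.
  - by move=> n; exact: measurable_itv.
  - by move=> n; apply: measurable_funTS; apply/measurable_EFinP; exact: measurable_pw.
  - by move=> n x _; rewrite lee_fin pw_ge0.
rewrite -UF; apply: (cvg_unique _ cv) => //.
rewrite (_ : (fun _ => _) = (fun n => (a^-1 - a^-1 * (n.+2%:R^-1) `^ a)%R%:E)); last first.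
  by apply/funext => n; rewrite integral_pw01_trunc.
apply: cvg_EFin; first by near=> n.
rewrite -[X in _ --> X]subr0; apply: cvgB; first exact: cvg_cst.
rewrite -(mulr0 (a^-1)%R); apply: cvgM; first exact: cvg_cst.
have /cvg_at_rightP := powR_cvg0 a0; apply; split; first by move=> n; case/andP: (e01 n).
by have := @cvg_harmonic R; rewrite -(@cvg_shiftS R^o).
Unshelve. all: by end_near. Qed.

(** The case b = 1 of the product formula, since B(a, 1) = 1 / a. *)
Lemma eGammaS (R : realType) (a : R) : (0 < a)%R -> eGamma (a + 1) = a%:E * eGamma a.
Proof.
move=> a0; have := eGamma_mul a 1; rewrite eGamma1 mule1 conv_pw1r// => ->.
by rewrite muleA -EFinM divff ?mul1e// gt_eqF.
Qed.

(** For exponents at most 1 the integrand is dominated by x^(b-1) on [0, 1] and by exp(-x) beyond,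
    two integrals already computed. The functional equation carries finiteness to larger
    exponents. *)
Lemma eGamma_lty (R : realType) (a : R) : (0 < a)%R -> eGamma a < +oo.
Proof.
have small (b : R) : (0 < b)%R -> (b <= 1)%R -> eGamma b < +oo.
  move=> b0 b1; have cG : conv_pw b 1 1 + @eGamma R 1 < +oo.
    by rewrite conv_pw1r// eGamma1 ltry.
  apply: le_lt_trans cG.
  have mb1 := measurable_conv_pw_l b 1 1; have m1 := measurable_eGamma (1%R : R).
  have p0 c d (x y : R) : (0 <= pw c x * pw d y)%R by rewrite mulr_ge0// pw_ge0.
  have e0 c (x y : R) : (0 <= pw c x * expR y)%R by rewrite mulr_ge0// ?pw_ge0// expR_ge0.
  rewrite /conv_pw /eGamma -ge0_integralD//; first last.
  - by move=> x _; rewrite lee_fin.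
  - by move=> x _; rewrite lee_fin.
  apply: ge0_le_integral => //.
  - by move=> x _; rewrite lee_fin.
  - exact: measurable_eGamma.
  - exact: emeasurable_funD.
  move=> x _; rewrite -EFinD lee_fin.
  have [x0|x0] := ltP x 0%R; first by rewrite !(pw_lt0 _ x0) !mul0r addr0.
  have [x1|x1] := leP x 1%R.
    rewrite !pw1 subr_ge0 x1 mulr1 -[leLHS]addr0 lerD// ?mulr_ge0 ?expR_ge0//.
    by rewrite ler_piMr ?pw_ge0// -expR0 ler_expR oppr_le0.
  rewrite -[leLHS]add0r lerD// ler_wpM2r ?expR_ge0// pw1 x0 /pw x0.
  by rewrite (le_trans (ler_powR (ltW x1) (_ : b - 1 <= 0)%R)) ?subr_le0 ?powRr0.
have [n an] : exists n : nat, (a <= n%:R)%R.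
  by exists (Num.truncn a).+1; rewrite ltW// truncnS_gt.
elim: n a an => [|n IH] a an a0; first by rewrite leNgt a0 in an.
have [a1|a1] := leP a 1%R; first exact: small.
rewrite -(subrK 1%R a) eGammaS ?subr_gt0//.
rewrite lte_mul_pinfty// ?lee_fin ?subr_ge0 ?(ltW a1)//.
by apply: IH; rewrite ?subr_gt0// lerBlDr -natr1 in an *.
Qed.

Lemma eGamma_gt0 (R : realType) (a : R) : 0 < eGamma a.
Proof.
have m12 : (1%R < 2%R :> R)%R by rewrite ltr1n.
(* A power of x is monotone, so on [1, 2] it is at least the smaller of its end values 1 and
   2^(a-1). *)
pose c : R := (Num.min 1 (2 `^ (a - 1)) * expR (- 2))%R.
have c0 : (0 < c)%R by rewrite mulr_gt0 ?expR_gt0// lt_min ltr01 powR_gt0.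
apply: (@lt_le_trans _ _ (\int[@lebesgue_measure R]_(x in `[1%R, 2%R]) c%:E)).
  rewrite integral_cst//= lebesgue_measure_itv/= lte_fin m12 -EFinD -EFinM lte_fin mulr_gt0// subr_gt0.
rewrite /eGamma [leLHS]integral_mkcond; apply: ge0_le_integral => //.
- by move=> x _; rewrite patchE; case: ifP => // _; rewrite lee_fin ltW.
- by apply/(measurable_restrictT _ _).1 => //; exact: measurable_cst.
- exact: measurable_eGamma.
move=> x _; rewrite patchE; case: ifPn; last first.
  by rewrite lee_fin mulr_ge0 ?pw_ge0 ?expR_ge0.
rewrite inE/= in_itv/= => /andP[x1 x2]; rewrite lee_fin /c.
have x0 : (0 <= x)%R by rewrite (le_trans _ x1).
rewrite ler_pM ?expR_ge0 ?le_min ?powR_ge0 ?ler01// ?ler_expR ?lerN2// /pw x0 ge_min.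
have [a1|a1] := leP 1%R a.
  by rewrite (le_trans _ (ler_powR x1 (_ : 0 <= a - 1)%R)) ?subr_ge0 ?powRr0.
rewrite -[(a - 1)%R]opprK opprB !powRN.
apply/orP; right; rewrite lef_pV2 ?posrE ?powR_gt0//; last exact: lt_le_trans x1.
by apply: ge0_ler_powR; rewrite ?nnegrE ?subr_ge0 ?(ltW a1).
Qed.

(** Since [fine] sends [+oo] to 0, this identification rests on [eGamma_lty]. *)
Lemma GammaE (R : realType) (a : R) : (0 < a)%R -> (Gamma a)%:E = eGamma a.
Proof.
move=> a0; rewrite -[RHS]fineK ?ge0_fin_numE ?eGamma_ge0 ?eGamma_lty//.
congr (fine _)%:E; rewrite integral_itv_obnd_cbnd; last first.
  by apply/measurable_EFinP/measurable_funM; apply: measurable_funTS => //; exact: measurable_expN.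
rewrite /eGamma integral_mkcond; apply: eq_integral => x _.
rewrite patchE /pw; case: ifPn; rewrite ?inE/= ?notin_setE/= in_itv/= andbT.
  by move=> ->.
by move=> /negP/negbTE ->; rewrite mul0r.
Qed.

Lemma Gamma_gt0 (R : realType) (a : R) : (0 < a)%R -> (0 < Gamma a)%R.
Proof. by move=> a0; rewrite -lte_fin GammaE// eGamma_gt0. Qed.

Lemma GammaS (R : realType) (a : R) : (0 < a)%R -> (Gamma (a + 1) = a * Gamma a)%R.
Proof. by move=> a0; apply: EFin_inj; rewrite EFinM !GammaE ?addr_gt0// eGammaS. Qed.

Lemma conv_pwE (R : realType) (a b s : R) : (0 < a)%R -> (0 < b)%R -> s != 0%R ->
  conv_pw a b s = (pw (a + b) s * (Gamma a * Gamma b / Gamma (a + b)))%:E.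
Proof.
move=> a0 b0; have ab0 := addr_gt0 a0 b0; have g0 := Gamma_gt0 ab0.
rewrite neq_lt => /orP[s0|s0]; first by rewrite conv_pw_lt0// pw_lt0// mul0r.
rewrite conv_pw_scale// EFinM; congr (_ * _).
have := eGamma_mul a b; rewrite -!GammaE// -EFinM.
have : 0 <= conv_pw a b 1 by apply: integral_ge0 => x _; rewrite lee_fin mulr_ge0// pw_ge0.
(* An infinite beta integral is impossible: multiplied by the positive [Gamma (a + b)] it would
   equal the finite product of the two Gamma values. *)
case: (conv_pw a b 1) => [r _|_|//]; last by rewrite gt0_mulye.
by rewrite -EFinM => -[->]; rewrite mulfK// gt_eqF.
Qed.

End EulerIntegrals.

(** * Iterated integrals and the Dirichlet integral *)

Section IteratedIntegral.
Set Implicit Arguments.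
Unset Strict Implicit.
Import numFieldNormedType.Exports.
Local Open Scope classical_set_scope.
Local Open Scope ereal_scope.

(** Tonelli gives measurability for nonnegative integrands; the signed case splits into positive and
    negative parts, whose difference is the integral by definition. *)
Lemma measurable_integral_param (R : realType) d (T : measurableType d)
    (h : T * R -> \bar R) : measurable_fun [set: T * R] h ->
  measurable_fun [set: T] (fun y => \int[@lebesgue_measure R]_x h (y, x)).
Proof.
move=> mh.
have -> : (fun y => \int[@lebesgue_measure R]_x h (y, x)) =
    (fun y => \int[@lebesgue_measure R]_x (h ^\+ (y, x)) -
              \int[@lebesgue_measure R]_x (h ^\- (y, x))).
  apply/funext => y; rewrite [LHS]integralE.
  by congr (_ - _); apply: eq_integral => x _; rewrite ?funeposE ?funenegE.
have mhp := measurable_funepos mh; have mhn := measurable_funeneg mh.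
apply: emeasurable_funB.
  exact: (measurable_fun_fubini_tonelli_F (m2 := @lebesgue_measure R) _ mhp (funepos_ge0 h)).
exact: (measurable_fun_fubini_tonelli_F (m2 := @lebesgue_measure R) _ mhn (funeneg_ge0 h)).
Qed.

(** The arbitrary parameter space [T] is what makes the induction run: each peeled variable joins
    the parameters. *)
Lemma measurable_iint (R : realType) (m : nat) d (T : measurableType d)
    (g : T -> m.-tuple R -> \bar R) :
  measurable_fun [set: T * m.-tuple R] (fun z => g z.1 z.2) ->
  measurable_fun [set: T] (fun y => iint (g y)).
Proof.
elim: m d T g => [|m IH] d T g mg /=.
  exact: (measurableT_comp mg (pair2_measurable [tuple])).
apply: (@measurable_integral_param R d T
  (fun z => iint (fun t => g z.1 (cons_tuple z.2 t)))).
apply: (IH _ _ (fun (z : T * R) t => g z.1 (cons_tuple z.2 t))).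
have mc : measurable_fun [set: (T * R) * m.-tuple R]
    (fun z => (z.1.1, cons_tuple z.1.2 z.2)).
  apply/measurable_fun_pairP; split => /=.
    exact: (measurableT_comp measurable_fst measurable_fst).
  apply: (measurable_cons (f := fun z : (T * R) * m.-tuple R => z.1.2)
     (g := fun z : (T * R) * m.-tuple R => z.2)).
    exact: (measurableT_comp measurable_snd measurable_fst).
  exact: measurable_snd.
exact: (measurableT_comp mg mc).
Qed.

Lemma measurable_cons2 (R : realType) (m : nat) :
  measurable_fun [set: R * m.-tuple R] (fun z => cons_tuple z.1 z.2).
Proof. exact: measurable_cons. Qed.

Lemma measurable_cons_tuple (R : realType) (m : nat) (x : R) :
  measurable_fun [set: m.-tuple R] (cons_tuple x).
Proof. exact: (measurable_cons (f := cst x) (g := id)). Qed.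

Lemma measurable_iint_cons (R : realType) (m : nat) (g : m.+1.-tuple R -> \bar R) :
  measurable_fun setT g ->
  measurable_fun [set: R] (fun x => iint (fun t => g (cons_tuple x t))).
Proof.
move=> mg; apply: (measurable_iint (g := fun x t => g (cons_tuple x t))).
exact: (measurableT_comp mg (@measurable_cons2 R m)).
Qed.

Lemma eq_iint (R : realType) (m : nat) (g h : m.-tuple R -> \bar R) :
  g =1 h -> iint g = iint h.
Proof. by move=> /funext ->. Qed.

Lemma iint_ge0 (R : realType) (m : nat) (g : m.-tuple R -> \bar R) :
  (forall t, 0 <= g t) -> 0 <= iint g.
Proof.
elim: m g => [|m IH] g g0 //=.
by apply: integral_ge0 => x _; exact: IH.
Qed.

Lemma ge0_le_iint (R : realType) (m : nat) (g h : m.-tuple R -> \bar R) :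
  measurable_fun setT g -> measurable_fun setT h ->
  (forall t, 0 <= g t) -> (forall t, g t <= h t) -> iint g <= iint h.
Proof.
elim: m g h => [|m IH] g h mg mh g0 gh //=.
have h0 t : 0 <= h t by exact: le_trans (gh t).
apply: ge0_le_integral => //.
- by move=> x _; exact: iint_ge0.
- exact: measurable_iint_cons.
- exact: measurable_iint_cons.
- move=> x _; apply: IH => //.
  + exact: (measurableT_comp mg (@measurable_cons_tuple R m x)).
  + exact: (measurableT_comp mh (@measurable_cons_tuple R m x)).
Qed.

Lemma ge0_iintZ (R : realType) (m : nat) (c : R) (g : m.-tuple R -> \bar R) :
  (0 <= c)%R -> measurable_fun setT g -> (forall t, 0 <= g t) ->
  iint (fun t => c%:E * g t) = c%:E * iint g.
Proof.
move=> c0; elim: m g => [|m IH] g mg g0 //=.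
rewrite -ge0_integralZl_EFin//.
- apply: eq_integral => x _; apply: IH => //.
  exact: (measurableT_comp mg (@measurable_cons_tuple R m x)).
- by move=> x _; exact: iint_ge0.
- exact: measurable_iint_cons.
Qed.

Lemma le_abse_iint (R : realType) (m : nat) (g : m.-tuple R -> \bar R) :
  measurable_fun setT g -> `|iint g| <= iint (fun t => `|g t|).
Proof.
elim: m g => [|m IH] g mg //=.
have mg' := measurable_iint_cons mg.
have mag : measurable_fun setT (fun t => `|g t|) by exact: measurableT_comp.
apply: (le_trans (le_abse_integral (@lebesgue_measure R) measurableT mg')).
apply: ge0_le_integral => //.
- exact: measurableT_comp.
- exact: (measurable_iint_cons mag).
- move=> x _; apply: IH.
  exact: (measurableT_comp mg (@measurable_cons_tuple R m x)).
Qed.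

Lemma iint_cons_integrable (R : realType) (m : nat) (g : m.+1.-tuple R -> \bar R) :
  measurable_fun setT g -> iint (fun t => `|g t|) < +oo ->
  (@lebesgue_measure R).-integrable setT (fun x => iint (fun t => g (cons_tuple x t))).
Proof.
move=> mg fg; have mg' := measurable_iint_cons mg.
apply/integrableP; split => //; apply: le_lt_trans fg.
apply: ge0_le_integral => //.
- exact: measurableT_comp.
- by apply: (measurable_iint_cons (g := fun t => `|g t|)); exact: measurableT_comp.
- move=> x _; apply: le_abse_iint.
  exact: (measurableT_comp mg (@measurable_cons_tuple R m x)).
Qed.

(** Absolute finiteness descends to the inner integrals only for almost every value of the outer
    variable, so the induction hypothesis is used off a null set and the outer integrands agree
    almost everywhere. *)
Lemma iintD (R : realType) (m : nat) (g h : m.-tuple R -> R) :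
  measurable_fun setT g -> measurable_fun setT h ->
  iint (fun t => `|(g t)%:E|) < +oo -> iint (fun t => `|(h t)%:E|) < +oo ->
  iint (fun t => (g t + h t)%:E) = iint (fun t => (g t)%:E) + iint (fun t => (h t)%:E).
Proof.
elim: m g h => [|m IH] g h mg mh fg fh; first by rewrite /= EFinD.
have mgE : measurable_fun setT (fun t => (g t)%:E) by exact/measurable_EFinP.
have mhE : measurable_fun setT (fun t => (h t)%:E) by exact/measurable_EFinP.
have mgA : measurable_fun setT (fun t => `|(g t)%:E|) by exact: measurableT_comp.
have mhA : measurable_fun setT (fun t => `|(h t)%:E|) by exact: measurableT_comp.
have fin u : measurable_fun setT u -> (forall t, 0 <= u t) ->
    @iint R m.+1 u < +oo ->
    {ae @lebesgue_measure R, forall x, setT x -> iint (fun t => u (cons_tuple x t)) \is a fin_num}.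
  move=> mu u0 fu; apply: integrable_ae => //; apply: iint_cons_integrable => //.
  by under eq_iint do rewrite gee0_abs//.
have ig := iint_cons_integrable mgE fg; have ih := iint_cons_integrable mhE fh.
rewrite /= -integralD//.
apply: ae_eq_integral => //.
- by apply: (measurable_iint_cons (g := fun t => (g t + h t)%:E)); apply/measurable_EFinP/measurable_funD.
- exact: emeasurable_funD (measurable_iint_cons mgE) (measurable_iint_cons mhE).
have [N1 [mN1 N10 sN1]] := fin _ mgA (fun t => abse_ge0 _) fg.
have [N2 [mN2 N20 sN2]] := fin _ mhA (fun t => abse_ge0 _) fh.
exists (N1 `|` N2); split; [exact: measurableU|by rewrite measureU0|].
move=> x /= nx; apply: contrapT => /not_orP[xN1 xN2]; apply: nx => _.
have f1 : iint (fun t => `|(g (cons_tuple x t))%:E|) < +oo.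
  rewrite -ge0_fin_numE ?iint_ge0//; apply: contrapT => nf; apply: xN1; apply: sN1 => /=.
  by move=> /(_ I).
have f2 : iint (fun t => `|(h (cons_tuple x t))%:E|) < +oo.
  rewrite -ge0_fin_numE ?iint_ge0//; apply: contrapT => nf; apply: xN2; apply: sN2 => /=.
  by move=> /(_ I).
apply: (IH (fun t => g (cons_tuple x t)) (fun t => h (cons_tuple x t))) => //.
- exact: (measurableT_comp mg (@measurable_cons_tuple R m x)).
- exact: (measurableT_comp mh (@measurable_cons_tuple R m x)).
Qed.

Lemma iintZ (R : realType) (m : nat) (c : R) (g : m.-tuple R -> R) :
  measurable_fun setT g -> iint (fun t => `|(g t)%:E|) < +oo ->
  iint (fun t => (c * g t)%:E) = c%:E * iint (fun t => (g t)%:E).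
Proof.
elim: m g => [|m IH] g mg fg; first by rewrite /= EFinM.
have mgE : measurable_fun setT (fun t => (g t)%:E) by exact/measurable_EFinP.
have mgA : measurable_fun setT (fun t => `|(g t)%:E|) by exact: measurableT_comp.
have fin : {ae @lebesgue_measure R, forall x, setT x ->
    iint (fun t => `|(g (cons_tuple x t))%:E|) \is a fin_num}.
  apply: integrable_ae => //.
  apply: (iint_cons_integrable (g := fun t => `|(g t)%:E|)) => //.
  by under eq_iint do rewrite abse_id.
have ig := iint_cons_integrable mgE fg.
rewrite /= -integralZl//.
apply: ae_eq_integral => //.
- by apply: (measurable_iint_cons (g := fun t => (c * g t)%:E)); apply/measurable_EFinP/measurable_funM.
- exact: measurable_funeM (measurable_iint_cons mgE).
have [N1 [mN1 N10 sN1]] := fin.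
exists N1; split => // x /= nx; apply: contrapT => xN1; apply: nx => _.
apply: (IH (fun t => g (cons_tuple x t))).
- exact: (measurableT_comp mg (@measurable_cons_tuple R m x)).
- rewrite -ge0_fin_numE ?iint_ge0//; apply: contrapT => nf; apply: xN1; apply: sN1 => /=.
  by move=> /(_ I).
Qed.

(** The total [s] is free and the exponents are indexed by [nat] so that removing the first variable
    gives a weight of the same form, with total [s - x] and exponents [a \o S]. *)
Definition dirichlet_weight (R : realType) (n : nat) (a : nat -> R) (s : R)
    (t : n.-tuple R) : R :=
  ((\prod_(i < n) pw (a i) (tnth t i)) * pw (a n) (s - \sum_(i < n) tnth t i))%R.

Lemma measurable_tnth_prod (R : realType) (n : nat) (f : nat -> R -> R) :
  (forall i, measurable_fun setT (f i)) ->
  measurable_fun [set: n.-tuple R] (fun t => (\prod_(i < n) f i (tnth t i))%R).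
Proof.
move=> mf; apply: measurable_prod => i _.
exact: measurableT_comp (mf i) (measurable_tnth i).
Qed.

Lemma measurable_dirichlet_weight (R : realType) (n : nat) (a : nat -> R) (s : R) :
  measurable_fun [set: n.-tuple R] (dirichlet_weight a s).
Proof.
apply: measurable_funM.
  by apply: (@measurable_tnth_prod R n (fun i => pw (a i))) => i; exact: measurable_pw.
apply: measurableT_comp; first exact: measurable_pw.
apply: measurable_funB => //; apply: measurable_sum => i.
exact: measurable_tnth.
Qed.

Lemma dirichlet_weight_ge0 (R : realType) (n : nat) (a : nat -> R) (s : R)
  (t : n.-tuple R) : (0 <= dirichlet_weight a s t)%R.
Proof. by rewrite mulr_ge0 ?pw_ge0// prodr_ge0// => i _; exact: pw_ge0. Qed.

Lemma dirichlet_weight_cons (R : realType) (n : nat) (a : nat -> R) (s x : R)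
  (t : n.-tuple R) :
  dirichlet_weight a s (cons_tuple x t) =
  (pw (a 0%N) x * dirichlet_weight (a \o S) (s - x) t)%R.
Proof.
rewrite /dirichlet_weight !big_ord_recl tnth0 opprD addrA -mulrA; congr (_ * (_ * _))%R.
  by apply: eq_bigr => i _; rewrite tnthS.
by congr (pw _ (_ - _)); apply: eq_bigr => i _; rewrite tnthS.
Qed.

(** Inductively the inner integral is a constant times a power of s - x, so the outer one is a beta
    convolution. The Gamma of the partial sum of exponents cancels between the two factors. *)
Lemma iint_dirichlet_weight (R : realType) (n : nat) (a : nat -> R) (s : R) :
  (forall i, 0 < a i)%R -> s != 0%R ->
  iint (fun t : n.-tuple R => (dirichlet_weight a s t)%:E) =
  (pw (\sum_(i < n.+1) a i) s *
   ((\prod_(i < n.+1) Gamma (a i)) / Gamma (\sum_(i < n.+1) a i)))%:E.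
Proof.
elim: n a s => [|n IH] a s a0 s0.
  rewrite /= /dirichlet_weight !big_ord0 !big_ord1 mul1r subr0 divff ?mulr1//.
  by rewrite gt_eqF// Gamma_gt0.
rewrite /=.
under eq_integral do under eq_iint do rewrite dirichlet_weight_cons EFinM.
have as0 : (0 < \sum_(i < n.+1) (a \o S) i)%R.
  rewrite big_ord_recl; apply: ltr_pwDl; first exact: a0.
  by apply: sumr_ge0 => i _; rewrite ltW// a0.
set K := ((\prod_(i < n.+1) Gamma ((a \o S) i)) / Gamma (\sum_(i < n.+1) (a \o S) i))%R.
have K0 : (0 <= K)%R.
  by rewrite divr_ge0 ?prodr_ge0 ?(ltW (Gamma_gt0 _))// => i _; rewrite ltW// Gamma_gt0// a0.
have mD x : measurable_fun [set: n.-tuple R] (fun t => (dirichlet_weight (a \o S) (s - x) t)%:E).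
  by apply/measurable_EFinP; exact: measurable_dirichlet_weight.
have D0 x (t : n.-tuple R) : 0 <= (dirichlet_weight (a \o S) (s - x) t)%:E.
  by rewrite lee_fin dirichlet_weight_ge0.
have mI : measurable_fun [set: R] (fun x => iint (fun t : n.-tuple R =>
    (pw (a 0%N) x)%:E * (dirichlet_weight (a \o S) (s - x) t)%:E)).
  have mI0 : measurable_fun [set: n.+1.-tuple R] (fun t => (dirichlet_weight a s t)%:E).
    by apply/measurable_EFinP; exact: measurable_dirichlet_weight.
  have := measurable_iint_cons mI0.
  congr (measurable_fun _ _); apply/funext => x; apply: eq_iint => t.
  by rewrite dirichlet_weight_cons EFinM.
transitivity (\int[@lebesgue_measure R]_x
    (K%:E * (pw (a 0%N) x * pw (\sum_(i < n.+1) (a \o S) i) (s - x))%:E)).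
  apply: ae_eq_integral => //.
    by apply: measurable_funeM; exact: measurable_conv_pw_l.
  (* The induction hypothesis asks for a nonzero total [s - x]; only the null point x = s is
     lost. *)
  apply: (@ae_except_point R s) => x xs _.
  rewrite ge0_iintZ ?pw_ge0// IH; last 2 first.
  - by move=> i; exact: a0.
  - by rewrite subr_eq0 eq_sym.
  by rewrite -!EFinM; congr (_%:E); rewrite -/K; ring.
rewrite ge0_integralZl_EFin//.
- rewrite -/(conv_pw _ _ _) conv_pwE// -EFinM; congr (_%:E).
  rewrite /K; set B := (\sum_(i < n.+1) _)%R; set A := (\prod_(i < n.+1) _)%R.
  have -> : (\sum_(i < n.+2) a i = a 0%N + B)%R by rewrite big_ord_recl.
  have -> : (\prod_(i < n.+2) Gamma (a i) = Gamma (a 0%N) * A)%R by rewrite big_ord_recl.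
  have B0 : Gamma B != 0%R by rewrite gt_eqF// Gamma_gt0.
  move: (Gamma B) B0 (Gamma (a 0%N)) (Gamma (a 0%N + B)) (pw _ _) => gB gB0 ga gAB p.
  rewrite [LHS](_ : _ = (p * (ga * A / gAB)) * (gB / gB))%R; last by ring.
  by rewrite divff ?mulr1.
- by move=> x _; rewrite lee_fin mulr_ge0// pw_ge0.
- exact: measurable_conv_pw_l.
Qed.

End IteratedIntegral.

(** * Dirichlet moments and Dunkl operators *)

Section DunklIntertwining.
Set Implicit Arguments.
Unset Strict Implicit.
Import -(notations) mpoly.
Local Opaque Gamma.

(** The exponent vector a + e_j: this shift multiplies the Dirichlet density by t_j. *)
Definition shift_at (R : realType) (N : nat) (a : 'I_N -> R) (j : 'I_N) : 'I_N -> R :=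
  fun p => a p + (p == j)%:R.

(** The multivariate beta function, identified with an integral in [iint_simplex_weight]. *)
Definition dirichlet_mass (R : realType) (N : nat) (a : 'I_N -> R) : R :=
  (\prod_p Gamma (a p)) / Gamma (\sum_p a p).

(* [dirichlet_moment l m a] is the integral over the simplex of
   [(l . t)^m * \prod_p t_p^(a_p - 1)]. *)
Fixpoint dirichlet_moment (R : realType) (N : nat) (l : 'I_N -> R) (m : nat)
    (a : 'I_N -> R) : R :=
  if m is m'.+1 then \sum_p l p * dirichlet_moment l m' (shift_at a p)
  else dirichlet_mass a.

Lemma shift_at_gt0 (R : realType) (N : nat) (a : 'I_N -> R) (j : 'I_N) :
  (forall p, 0 < a p) -> forall p, 0 < shift_at a j p.
Proof. by move=> a0 p; rewrite ltr_wpDr. Qed.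

Lemma shift_atC (R : realType) (N : nat) (a : 'I_N -> R) (i j : 'I_N) :
  shift_at (shift_at a i) j = shift_at (shift_at a j) i.
Proof. by apply/funext => p; rewrite /shift_at addrAC. Qed.

Lemma sum_shift_at (R : realType) (N : nat) (a : 'I_N -> R) (j : 'I_N) :
  \sum_p shift_at a j p = \sum_p a p + 1.
Proof.
rewrite big_split/=; congr (_ + _).
by rewrite (bigD1 j)//= eqxx big1 ?addr0// => i /negbTE ->.
Qed.

Lemma sum_gt0 (R : realType) (N : nat) (a : 'I_N -> R) (j : 'I_N) :
  (forall p, 0 < a p) -> 0 < \sum_p a p.
Proof.
move=> a0; rewrite (bigD1 j)//= ltr_pwDl// sumr_ge0// => i _.
by rewrite ltW.
Qed.

Lemma dirichlet_mass_shift (R : realType) (N : nat) (a : 'I_N -> R) (j : 'I_N) :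
  (forall p, 0 < a p) ->
  (\sum_p a p) * dirichlet_mass (shift_at a j) = a j * dirichlet_mass a.
Proof.
move=> a0; have s0 := sum_gt0 j a0.
rewrite /dirichlet_mass sum_shift_at GammaS//.
have -> : \prod_p Gamma (shift_at a j p) = a j * \prod_p Gamma (a p).
  rewrite [in RHS](bigD1 j)//= [LHS](bigD1 j)//=.
  rewrite /shift_at eqxx GammaS// mulrA; congr (_ * _).
  by apply: eq_bigr => i /negbTE ->; rewrite addr0.
have gs0 : Gamma (\sum_p a p) != 0 by rewrite gt_eqF// Gamma_gt0.
move: (Gamma _) gs0 (\prod_p _) => g g0 P; move: (a j) => b.
by field; rewrite g0 gt_eqF.
Qed.

(** Unfold one factor l . t and apply the induction hypothesis at a + e_p: its total is larger by
    one, which supplies the missing unit of m + 1, and its j-th entry is a_j plus a Kronecker delta,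
    which supplies one more copy of the last term. *)
Lemma dirichlet_moment_rec (R : realType) (N : nat) (l : 'I_N -> R) (m : nat)
    (a : 'I_N -> R) (j : 'I_N) : (forall p, 0 < a p) ->
  (m%:R + \sum_p a p) * dirichlet_moment l m (shift_at a j) =
  a j * dirichlet_moment l m a + m%:R * l j * dirichlet_moment l m.-1 (shift_at a j).
Proof.
elim: m a => [|m IH] a a0; first by rewrite add0r !mul0r addr0 /= dirichlet_mass_shift.
rewrite [dirichlet_moment l m.+1 (shift_at a j)]/= mulr_sumr.
transitivity (\sum_p (a j * (l p * dirichlet_moment l m (shift_at a p)) +
    (j == p)%:R * (l p * dirichlet_moment l m (shift_at a p)) +
    m%:R * l j * (l p * dirichlet_moment l m.-1 (shift_at (shift_at a j) p)))).
  apply: eq_bigr => p _; rewrite mulrCA shift_atC.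
  have := IH (shift_at a p) (shift_at_gt0 p a0); rewrite sum_shift_at => E.
  rewrite (_ : m.+1%:R + \sum_p a p = m%:R + (\sum_p a p + 1)); last by rewrite -natr1; ring.
  by rewrite E {1}/shift_at; ring.
rewrite !big_split/= -!mulr_sumr -addrA; congr (_ + _).
rewrite (bigD1 j)//= eqxx mul1r [X in _ + X + _]big1 ?addr0; last first.
  by move=> p; rewrite eq_sym => /negbTE ->; rewrite mul0r.
(* At degree 0 the meaningless predecessor is killed by its coefficient; otherwise the last sum
   folds back into a moment. *)
case: m {IH} => [|m]; first by rewrite !mul0r addr0 mul1r.
by rewrite [X in _ + _ * X](_ : _ = dirichlet_moment l m.+1 (shift_at a j))// -(natr1 m.+1); ring.
Qed.

(** The algebraic counterpart of \sum_j t_j = 1. *)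
Lemma sum_dirichlet_moment_shift (R : realType) (N : nat) (l : 'I_N -> R) (m : nat)
    (a : 'I_N -> R) : (0 < N)%N -> (forall p, 0 < a p) ->
  \sum_j dirichlet_moment l m (shift_at a j) = dirichlet_moment l m a.
Proof.
move=> N0; elim: m a => [|m IH] a a0 /=.
  have s0 := sum_gt0 (Ordinal N0) a0.
  apply: (mulfI (lt0r_neq0 s0)); rewrite mulr_sumr.
  by under eq_bigr do rewrite dirichlet_mass_shift//; rewrite -mulr_suml.
rewrite exchange_big/=; apply: eq_bigr => p _; rewrite -mulr_sumr; congr (_ * _).
under eq_bigr do rewrite shift_atC.
by apply: IH; exact: shift_at_gt0.
Qed.

Lemma dirichlet_moment_perm (R : realType) (N : nat) (l : 'I_N -> R) (m : nat)
    (a : 'I_N -> R) (s : {perm 'I_N}) :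
  dirichlet_moment (l \o s) m (a \o s) = dirichlet_moment l m a.
Proof.
elim: m a => [|m IH] a /=.
  have Es : \sum_p a p = \sum_p (a \o s) p by exact: (reindex_inj (@perm_inj _ s)).
  have Ep : \prod_p Gamma (a p) = \prod_p Gamma ((a \o s) p).
    exact: (reindex_inj (@perm_inj _ s)).
  by rewrite /dirichlet_mass Es Ep.
rewrite [RHS](reindex_inj (@perm_inj _ s)); apply: eq_bigr => p _.
rewrite -IH; congr (_ * dirichlet_moment _ _ _); apply/funext => i.
by rewrite /shift_at /= (inj_eq perm_inj).
Qed.

(** Polynomiality in [l] is what later extends an identity from points with distinct coordinates to
    all points. *)
Lemma dirichlet_moment_mpoly (R : realType) (N : nat) (m : nat) (a : 'I_N -> R) :
  exists P : mpoly.mpoly N R, forall l, mpoly.meval l P = dirichlet_moment l m a.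
Proof.
elim: m a => [|m IH] a /=.
  by exists (mpolyC _ (dirichlet_mass a)) => l; rewrite mevalC.
have [P hP] := choice (fun p => IH (shift_at a p)).
exists (\sum_p mpolyX R (mnm1 p) * P p) => l.
by rewrite raddf_sum; apply: eq_bigr => p _; rewrite /= mevalM mevalXU hP.
Qed.

Lemma swap_ptE (R : realType) (N : nat) (i j : 'I_N) (l : 'I_N -> R) :
  swap_pt i j l = l \o tperm i j.
Proof.
apply/funext => p; rewrite /swap_pt /=.
by case: tpermP => [->|->|/eqP/negbTE -> /eqP/negbTE ->]; rewrite ?eqxx//; case: eqP => // ->.
Qed.

(** Constant exponents are invariant under permutations, so transposing the point only relocates the
    extra unit of exponent. *)
Lemma dirichlet_moment_swap (R : realType) (N : nat) (l : 'I_N -> R) (m : nat)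
    (k : R) (i p j : 'I_N) :
  dirichlet_moment (swap_pt i p l) m (shift_at (fun=> k) j) =
  dirichlet_moment l m (shift_at (fun=> k) (tperm i p j)).
Proof.
rewrite swap_ptE -[RHS](dirichlet_moment_perm _ _ _ (tperm i p)).
congr dirichlet_moment; apply/funext => q.
by rewrite /shift_at /= (inj_eq perm_inj).
Qed.

(** Only ordered pairs with an entry j move j, and each transposition (j p) occurs twice; the factor
    k / 2 of the recursion absorbs this 2. *)
Lemma sum_tperm_diff (R : realType) (N : nat) (P : 'I_N -> R) (j : 'I_N) :
  \sum_i \sum_p (P j - P (tperm i p j)) = 2 * \sum_p (P j - P p).
Proof.
rewrite (bigD1 j)//= mulr_natl mulr2n; congr (_ + _).
  by apply: eq_bigr => p _; rewrite tpermL.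
rewrite [RHS](bigD1 j)//= subrr add0r; apply: eq_bigr => i ij.
rewrite (bigD1 j)//= tpermR big1 ?addr0// => p pj.
by rewrite tpermD ?subrr// eq_sym.
Qed.

(** The reflection sum collapses to 2 (N P_j - \sum_p P_p), and the last sum is the unshifted
    moment; what remains is [dirichlet_moment_rec] at constant exponents. *)
Lemma dirichlet_moment_dunkl_euler (R : realType) (N : nat) (l : 'I_N -> R)
    (m : nat) (k : R) (j : 'I_N) : 0 < k ->
  let P m j l := dirichlet_moment l m (shift_at (fun=> k) j) in
  m%:R * P m j l + k / 2 * \sum_i \sum_p (P m j l - P m j (swap_pt i p l)) =
  m%:R * l j * P m.-1 j l.
Proof.
move=> k0 P; have N0 : (0 < N)%N by exact: leq_ltn_trans (ltn_ord j).
rewrite (eq_bigr (fun i => \sum_p (P m j l - P m (tperm i p j) l))); last first.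
  by move=> i _; apply: eq_bigr => p _; rewrite /P dirichlet_moment_swap.
rewrite (sum_tperm_diff (fun j => P m j l)) sumrB.
rewrite sum_dirichlet_moment_shift// sumr_const card_ord.
have := @dirichlet_moment_rec R N l m (fun=> k) j (fun=> k0).
rewrite sumr_const card_ord -/(P m j l) -/(P m.-1 j l) -(mulr_natr k) -mulr_natl => E.
rewrite -[RHS](addKr (k * dirichlet_moment l m (fun=> k))) -E.
by field.
Qed.

(* At a maximum of [d] on the permutation orbit of [l] the reflection terms are
   nonnegative, hence [d <= 0] there; apply this to [- d] as well. *)
Lemma dunkl_maximum_principle (R : realType) (N m : nat) (k : R)
    (d : ('I_N -> R) -> R) : 0 < k -> (0 < m)%N ->
  (forall l, injective l ->
    m%:R * d l + k / 2 * \sum_i \sum_p (d l - d (swap_pt i p l)) = 0) ->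
  forall l, injective l -> d l = 0.
Proof.
move=> k0 m0.
have main (e : ('I_N -> R) -> R) : (forall l, injective l ->
    m%:R * e l + k / 2 * \sum_i \sum_p (e l - e (swap_pt i p l)) = 0) ->
    forall l, injective l -> e l <= 0.
  move=> He l linj.
  pose s := [arg max_(t > 1%g : {perm 'I_N}) e (l \o t)]%O.
  have smax (t : {perm 'I_N}) : e (l \o t) <= e (l \o s).
    by rewrite /s; case: arg_maxP => //= i _ H; exact: H.
  have := He (l \o s) (inj_comp linj perm_inj).
  apply: contra_eqT; rewrite -ltNge => el.
  have els : 0 < e (l \o s).
    by apply: (lt_le_trans el); have := smax 1%g; congr (e _ <= _); apply/funext => i /=; rewrite perm1.
  rewrite gt_eqF// ltr_wpDr ?mulr_gt0 ?ltr0n// mulr_ge0 ?divr_ge0 ?(ltW k0)//.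
  rewrite sumr_ge0// => i _; rewrite sumr_ge0// => p _; rewrite subr_ge0 swap_ptE.
  by have := smax (tperm i p * s)%g; congr (e _ <= _); apply/funext => q /=; rewrite permM.
move=> Hd l linj; apply/eqP; rewrite eq_le main//=.
rewrite -oppr_le0; apply: (main (fun l => - d l)) => // l' l'inj.
rewrite (eq_bigr (fun i => - \sum_p (d l' - d (swap_pt i p l')))); last first.
  by move=> i _; rewrite -sumrN; apply: eq_bigr => p _; rewrite opprB opprK addrC.
by rewrite sumrN !mulrN -opprD Hd// oppr0.
Qed.

(** Multiplying [u] by the monic polynomial with root list [B] makes it vanish everywhere. *)
Lemma poly_eq0_off_finite (R : realType) (u : {poly R}) (B : seq R) :
  (forall x, x \notin B -> u.[x] = 0) -> u = 0.
Proof.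
move=> uB; pose w := u * \prod_(b <- B) ('X - b%:P).
have w0 x : root w x.
  rewrite /root hornerM horner_prod mulf_eq0.
  have [xB|/uB ->] := boolP (x \in B); last by rewrite eqxx.
  by rewrite (big_rem x)//= hornerXsubC subrr mul0r eqxx orbT.
have wz : w = 0.
  apply: (@roots_geq_poly_eq0 _ _ [seq i%:R | i <- iota 0 (size w)]).
  - by apply/allP => x _; exact: w0.
  - by rewrite map_inj_uniq ?iota_uniq// => i j /eqP; rewrite eqr_nat => /eqP.
  - by rewrite size_map size_iota.
apply/eqP; move/eqP: wz; rewrite /w mulf_eq0 => /orP[//|].
by rewrite (negbTE (monic_neq0 (monic_prod_XsubC _ _ _))).
Qed.

(** Restrict [e] to the line through [l] with direction (0, 1, 2, ...). Its slopes are distinct, so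
    two coordinates collide for only finitely many parameters; the parameter 0 gives back [l]. *)
Lemma meval_eq0_off_diagonals (R : realType) (N : nat) (e : mpoly.mpoly N R) :
  (forall l, injective l -> mpoly.meval l e = 0) -> forall l, mpoly.meval l e = 0.
Proof.
move=> e0 l.
pose u : {poly R} := \sum_(m <- msupp e) (mcoeff m e)%:P *
  \prod_i ((l i)%:P + (i%:R : R) *: 'X) ^+ (fun_of_multinom m i).
have uE x : u.[x] = mpoly.meval (fun i => l i + i%:R * x) e.
  rewrite mevalE horner_sum; apply: eq_bigr => m _.
  rewrite hornerM hornerC horner_prod; congr (_ * _); apply: eq_bigr => i _.
  by rewrite horner_exp hornerD hornerC hornerZ hornerX.
have -> : mpoly.meval l e = u.[0].
  by rewrite uE; apply: meval_eq => i; rewrite mulr0 addr0.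
(* The list holds the solutions x of l_i + i x = l_p + p x; pairs with equal entries merely
   contribute 0. *)
rewrite (@poly_eq0_off_finite R u [seq (l z.2 - l z.1) / (z.1%:R - z.2%:R) | z <- enum {: 'I_N * 'I_N}]) ?horner0//.
move=> x xB; rewrite uE; apply: e0 => i p ip; apply: contraNeq xB => inp.
apply/mapP; exists (i, p); rewrite ?mem_enum//=.
have nz : (i%:R - p%:R : R) != 0 by rewrite subr_eq0 eqr_nat.
apply: (mulIf nz); rewrite divfK//.
by rewrite mulrBr -[RHS](addrK (l i + i%:R * x)) {2}ip; ring.
Qed.

Lemma euler_mpoly (R : realType) (N m : nat) (q : mpoly.mpoly N R) (l : 'I_N -> R) :
  homog_deg m q ->
  \sum_i l i * mpoly.meval l (mpoly.mderiv i q) = m%:R * mpoly.meval l q.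
Proof.
move=> /allP hq; rewrite [in RHS]mevalE mulr_sumr.
under eq_bigr do rewrite /mderiv raddf_sum/= mulr_sumr.
rewrite exchange_big/= big_seq [RHS]big_seq; apply: eq_bigr => s /hq /= /eqP <-.
rewrite mdegE natr_sum mulr_suml; apply: eq_bigr => i _.
(* For exponent 0 the truncated subtraction does not lower the monomial, but its coefficient
   vanishes. *)
rewrite mevalZ mevalX; have [s0|s0] := eqVneq (fun_of_multinom s i) 0%N.
  by rewrite s0 !mul0r mulr0.
rewrite -!mulrA !(mulrCA (l i)); congr (_ * (_ * _)).
rewrite [RHS](bigD1 i)//= [X in _ * X](bigD1 i)//= mulrA; congr (_ * _).
  by rewrite mnmBE mnm1E eqxx -exprS subn1 prednK// lt0n.
by apply: eq_bigr => p pi; rewrite mnmBE mnm1E eq_sym (negbTE pi) subn0.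
Qed.

(* The reflection terms pair up since
   [l i / (l i - l p) + l p / (l p - l i) = 1]. *)
Lemma sum_dunkl_euler (R : realType) (N m : nat) (k : R) (q : mpoly.mpoly N R)
    (l : 'I_N -> R) : homog_deg m q -> injective l ->
  \sum_i l i * dunkl k i q l =
  m%:R * mpoly.meval l q +
  k / 2 * \sum_i \sum_p (mpoly.meval l q - mpoly.meval (swap_pt i p l) q).
Proof.
move=> hq linj; rewrite -(euler_mpoly _ hq) /dunkl.
under eq_bigr do rewrite mulrDr; rewrite big_split/=; congr (_ + _).
pose D i p := mpoly.meval l q - mpoly.meval (swap_pt i p l) q.
have DC i p : D i p = D p i by rewrite /D !swap_ptE tpermC.
have D0 i : D i i = 0.
  rewrite /D swap_ptE tperm1 (_ : l \o _ = l) ?subrr//.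
  by apply/funext => p /=; rewrite perm1.
pose G := \sum_i \sum_p l i * (D i p / (l i - l p)).
have -> : \sum_i l i * (k * \sum_(p < N | p != i)
    (mpoly.meval l q - mpoly.meval (swap_pt p i l) q) / (l i - l p)) = k * G.
  rewrite mulr_sumr; apply: eq_bigr => i _; rewrite mulrCA; congr (_ * _).
  rewrite -mulr_sumr; congr (_ * _); rewrite [RHS](bigD1 i)//= D0 mul0r add0r.
  by apply: eq_bigr => p _; rewrite -/(D p i) DC.
rewrite -/D.
suff -> : \sum_i \sum_p D i p = G + G by field.
have G2 : G = \sum_i \sum_p l p * (D i p / (l p - l i)).
  rewrite /G exchange_big/=; apply: eq_bigr => i _; apply: eq_bigr => p _.
  by rewrite (DC p i).
rewrite {2}G2 -big_split/=; apply: eq_bigr => i _.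
rewrite -big_split/=; apply: eq_bigr => p _.
have [->|ip] := eqVneq i p; first by rewrite D0 !mul0r !mulr0 addr0.
have nz : l i - l p != 0 by rewrite subr_eq0 (inj_eq linj).
have nz' : l p - l i != 0 by rewrite -opprB oppr_eq0.
by move: (D i p) => x; field; rewrite nz nz'.
Qed.

End DunklIntertwining.

(** * Bernstein approximation *)

Section BernsteinApproximation.
Set Implicit Arguments.
Unset Strict Implicit.
Import numFieldNormedType.Exports.
Local Open Scope classical_set_scope.

(* Expectation of [h] under the binomial law of parameters [n] and [y]. *)
Fixpoint bernstein (R : realType) (n : nat) (h : nat -> R) (y : R) : R :=
  if n is n'.+1 then y * bernstein n' (h \o S) y + (1 - y) * bernstein n' h y
  else h 0%N.

Lemma le_bernstein (R : realType) (n : nat) (h g : nat -> R) (y : R) :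
  0 <= y <= 1 -> (forall i, (i <= n)%N -> h i <= g i) ->
  bernstein n h y <= bernstein n g y.
Proof.
move=> /andP[y0 y1]; elim: n h g => [|n IH] h g hg /=; first exact: hg.
rewrite lerD// ler_wpM2l ?subr_ge0//; apply: IH => i ni; apply: hg => //.
exact: leqW.
Qed.

Lemma bernstein_affine (R : realType) (n : nat) (h : nat -> R) (c d y : R) :
  bernstein n (fun i => c * h i + d) y = c * bernstein n h y + d.
Proof.
elim: n h => [//|n IH] h /=.
by rewrite (IH (h \o S)) (IH h); ring.
Qed.

(** Variance plus squared bias of a binomial count. The centre [z] is free because a success in one
    trial shifts it to z - 1. *)
Lemma bernstein_sqr (R : realType) (n : nat) (z y : R) :
  bernstein n (fun i => (i%:R - z) ^+ 2) y = n%:R * y * (1 - y) + (n%:R * y - z) ^+ 2.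
Proof.
elim: n z => [|n IH] z /=; first by ring.
rewrite (_ : (fun i => (i%:R - z) ^+ 2) \o S = fun i => (i%:R - (z - 1)) ^+ 2).
  by rewrite !IH -natr1; ring.
by apply/funext => i /=; rewrite -natr1; congr (_ ^+ 2); ring.
Qed.

Lemma bernstein_poly (R : realType) (n : nat) (h : nat -> R) (u : {poly R}) :
  exists p : {poly R}, forall x, p.[x] = bernstein n h u.[x].
Proof.
elim: n h => [|n IH] h /=; first by exists (h 0%N)%:P => x; rewrite hornerC.
have [p1 E1] := IH (h \o S); have [p2 E2] := IH h.
exists (u * p1 + (1 - u) * p2) => x.
by rewrite hornerD !hornerM hornerD hornerN hornerC E1 E2.
Qed.

Lemma lipschitz_poly_approx (R : realType) (f : R -> R) (r L e : R) :
  0 < r -> 0 <= L -> 0 < e ->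
  (forall x y, `|x| <= r -> `|y| <= r -> `|f x - f y| <= L * `|x - y|) ->
  exists p : {poly R}, forall x, `|x| <= r -> `|f x - p.[x]| <= e.
Proof.
move=> r0 L0 e0 Lf.
(* With A = 2 r L, this makes A t <= e/2 + K t^2 for all t: the Lipschitz error is traded for a
   square, whose binomial mean is a variance. *)
pose K := (2 * r * L) ^+ 2 / (2 * e).
have K0 : 0 <= K by rewrite divr_ge0 ?sqr_ge0// mulr_ge0// ltW.
(* The mean of K (i/n - y)^2 is K y (1 - y) / n, hence at most K / n, which n > 2 K / e brings below
   e / 2. *)
pose n := (Num.truncn (2 * K / e)).+1.
have n0 : 0 < n%:R :> R by rewrite ltr0n.
have nK : K / n%:R <= e / 2.
  have : 2 * K / e < n%:R by exact: truncnS_gt.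
  rewrite ltr_pdivrMr// => h; rewrite ler_pdivrMr//.
  by move: h; lra.
pose h i := f (2 * r * (i%:R / n%:R) - r).
have [p hp] := bernstein_poly n h ((2 * r)^-1 *: ('X + r%:P)).
exists p => x xr; rewrite hp hornerZ hornerD hornerX hornerC.
set y := _ * _; have r2 : 0 < 2 * r by rewrite mulr_gt0.
have xy : x = 2 * r * y - r by rewrite /y mulrA divff ?mul1r ?addrK// gt_eqF.
have y01 : 0 <= y <= 1.
  move: xr; rewrite ler_norml => /andP[xr1 xr2].
  apply/andP; split; first by rewrite mulr_ge0 ?invr_ge0 ?(ltW r2)//; lra.
  by rewrite /y ler_pdivrMl// mulr1; lra.
have key i : (i <= n)%N -> `|f x - h i| <= e / 2 + K * (i%:R / n%:R - y) ^+ 2.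
  move=> ni; have in01 : 0 <= i%:R / n%:R :> R by rewrite divr_ge0.
  have in1 : i%:R / n%:R <= 1 :> R by rewrite ler_pdivrMr// mul1r ler_nat.
  have nr : `|2 * r * (i%:R / n%:R) - r| <= r.
    rewrite ler_norml; apply/andP; split.
      have := mulr_ge0 (ltW r2) in01; lra.
    have := ler_wpM2l (ltW r2) in1; lra.
  apply: (le_trans (Lf _ _ xr nr)).
  have -> : x - (2 * r * (i%:R / n%:R) - r) = 2 * r * (y - i%:R / n%:R) by rewrite {1}xy; ring.
  rewrite normrM (gtr0_norm r2) -(sqrrN (_ - y)) opprB -(real_normK (num_real (y - _))).
  set t := `|y - _|; rewrite mulrA (mulrC L).
  (* AM-GM *)
  have -> : e / 2 + K * t ^+ 2 = 2 * r * L * t + (2 * e)^-1 * (e - 2 * r * L * t) ^+ 2.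
    by rewrite /K; field; rewrite gt_eqF.
  by rewrite lerDl mulr_ge0 ?sqr_ge0// invr_ge0 mulr_ge0// ltW.
have sq : bernstein n (fun i => K / n%:R ^+ 2 * (i%:R - n%:R * y) ^+ 2 + e / 2) y <= e.
  rewrite (bernstein_affine _ (fun i => (i%:R - n%:R * y) ^+ 2)) bernstein_sqr subrr.
  rewrite (_ : _ + e / 2 = K / n%:R * (y * (1 - y)) + e / 2); last first.
    by field; rewrite gt_eqF.
  have : K / n%:R * (y * (1 - y)) <= K / n%:R.
    rewrite ler_piMr ?divr_ge0 ?(ltW n0)//; case/andP: y01 => y0 y1; nra.
  by move: nK; lra.
have bd i : (i <= n)%N -> `|f x - h i| <= K / n%:R ^+ 2 * (i%:R - n%:R * y) ^+ 2 + e / 2.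
  move=> ni; rewrite (le_trans (key i ni))// addrC lerD2r le_eqVlt; apply/orP; left.
  by apply/eqP; field; rewrite gt_eqF.
rewrite ler_norml; apply/andP; split.
  rewrite lerBrDl lerBlDr -[leLHS]/(bernstein n h y) (le_trans (le_bernstein (g := fun i => 1 * (K / n%:R ^+ 2 * (i%:R - n%:R * y) ^+ 2 + e / 2) + f x) y01 _))//.
    by move=> i /bd; rewrite ler_norml => /andP[]; lra.
  by rewrite (bernstein_affine _ (fun i => K / n%:R ^+ 2 * (i%:R - n%:R * y) ^+ 2 + e / 2)); lra.
have -> : f x - bernstein n h y = bernstein n (fun i => -1 * h i + f x) y.
  by rewrite bernstein_affine; ring.
apply: le_trans sq; apply: le_bernstein => // i /bd; rewrite ler_norml => /andP[]; lra.
Qed.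

(** The constant is the maximum of |f'| on [-r, r], attained because f' is differentiable, hence
    continuous; the mean value theorem does the rest. *)
Lemma smooth_lipschitz (R : realType) (f : R -> R) (r : R) : smooth f -> 0 < r ->
  exists2 L, 0 <= L &
    forall x y, `|x| <= r -> `|y| <= r -> `|f x - f y| <= L * `|x - y|.
Proof.
move=> sf r0.
have df x : derivable f x 1 by exact: (sf 0%N x).
have ddf x : derivable (derive1 f) x 1 by exact: (sf 1%N x).
have cont g : (forall x : R, derivable g x 1) -> forall a b : R, {within `[a, b], continuous g}.
  move=> dg a b; apply: continuous_subspaceT => x.
  by apply: differentiable_continuous; exact/derivable1_diffP.
have rr : - r <= r by rewrite ge0_cp// ltW.
have cn : {within `[- r, r], continuous (fun x => `|derive1 f x|)}.
  move=> x; apply: continuous_comp; first exact: cont.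
  exact: norm_continuous.
have [c _ cmax] := EVT_max rr cn.
exists `|derive1 f c| => // x y; wlog xy : x y / x <= y.
  move=> H; have [xy|yx] := leP x y; first exact: H.
  by move=> xr yr; rewrite distrC (distrC x); apply: H => //; exact: ltW.
move=> xr yr.
have [z zxy E] : exists2 z, z \in `[x, y]%R & f y - f x = derive1 f z * (y - x).
  apply: (MVT_segment xy); last exact: cont.
  by move=> z _; rewrite derive1E; apply/derivableP.
rewrite (distrC (f x)) (distrC x) E normrM ler_wpM2r// cmax//.
move: zxy; rewrite !in_itv/= => /andP[xz zy].
move: xr yr; rewrite !ler_norml => /andP[x1 x2] /andP[y1 y2].
by rewrite (le_trans x1 xz) (le_trans zy y2).
Qed.

Lemma smooth_measurable (R : realType) (f : R -> R) : smooth f -> measurable_fun [set: R] f.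
Proof.
move=> sf; apply: continuous_measurable_fun => x.
by apply: differentiable_continuous; apply/derivable1_diffP; exact: (sf 0%N x).
Qed.

(** A domain closed under linear combinations that contains smooth functions, polynomials and their
    differences; a bound is asked only on [-r, r], where the functionals look. *)
Definition bounded_measurable (R : realType) (r : R) (f : R -> R) : Prop :=
  measurable_fun [set: R] f /\ exists M, forall x, `|x| <= r -> `|f x| <= M.

Lemma bounded_measurableD (R : realType) (r : R) (f g : R -> R) :
  bounded_measurable r f -> bounded_measurable r g ->
  bounded_measurable r (fun x => f x + g x).
Proof.
move=> [mf [M hM]] [mg [M' hM']]; split; first exact: measurable_funD.
exists (M + M') => x xr.
by rewrite (le_trans (ler_normD _ _))// lerD ?hM ?hM'.
Qed.

Lemma bounded_measurableZ (R : realType) (r c : R) (f : R -> R) :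
  bounded_measurable r f -> bounded_measurable r (fun x => c * f x).
Proof.
move=> [mf [M hM]]; split; first exact: measurable_funM.
by exists (`|c| * M) => x xr; rewrite normrM ler_wpM2l ?hM.
Qed.

Lemma bounded_measurableX (R : realType) (r : R) (m : nat) :
  bounded_measurable r (fun x => x ^+ m).
Proof.
split; first exact: measurable_funX.
exists (r ^+ m) => x xr; rewrite normrX lerXn2r ?nnegrE//.
exact: le_trans xr.
Qed.

Lemma smooth_bounded_measurable (R : realType) (r : R) (f : R -> R) :
  0 < r -> smooth f -> bounded_measurable r f.
Proof.
move=> r0 sf; split; first exact: smooth_measurable.
have [L L0 Lf] := smooth_lipschitz sf r0.
exists (`|f 0| + L * r) => x xr.
rewrite -[f x](subrK (f 0)) addrC (le_trans (ler_normD _ _))// lerD2l.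
rewrite (le_trans (Lf _ _ xr _)) ?normr0 ?(ltW r0)// subr0.
by rewrite ler_wpM2l.
Qed.

(** An abstraction of integration against a measure of mass [C] carried by [-r, r]: linearity and a
    bound by the supremum on that interval, common to both sides of the theorem. *)
Definition local_functional (R : realType) (r C : R) (Lam : (R -> R) -> R) : Prop :=
  [/\ forall f g, bounded_measurable r f -> bounded_measurable r g ->
        Lam (fun x => f x + g x) = Lam f + Lam g,
      forall c f, bounded_measurable r f -> Lam (fun x => c * f x) = c * Lam f &
      forall e f, 0 <= e -> bounded_measurable r f ->
        (forall x, `|x| <= r -> `|f x| <= e) -> `|Lam f| <= C * e].

Lemma bounded_measurable_sum (R : realType) (r : R) (c : nat -> R) (m : nat) :
  bounded_measurable r (fun x => \sum_(i < m) c i * x ^+ i).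
Proof.
elim: m => [|m IH].
  split; last by exists 0 => x _; rewrite big_ord0 normr0.
  by rewrite (_ : (fun x => _) = cst 0)//; apply/funext => x; rewrite big_ord0.
rewrite (_ : (fun x => _) = (fun x => \sum_(i < m) c i * x ^+ i + c m * x ^+ m)); last first.
  by apply/funext => x; rewrite big_ord_recr.
by apply: bounded_measurableD => //; apply/bounded_measurableZ/bounded_measurableX.
Qed.

Lemma eq_local_functional (R : realType) (r C1 C2 : R) (L1 L2 : (R -> R) -> R) :
  0 < r -> local_functional r C1 L1 -> local_functional r C2 L2 ->
  (forall m, L1 (fun x => x ^+ m) = L2 (fun x => x ^+ m)) ->
  forall f, smooth f -> L1 f = L2 f.
Proof.
move=> r0 [D1 Z1 B1] [D2 Z2 B2] L12 f sf.
have bf := smooth_bounded_measurable r0 sf.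
have L0 (L : (R -> R) -> R) : (forall c g, bounded_measurable r g -> L (fun x => c * g x) = c * L g) ->
    L (fun=> 0) = 0.
  move=> Z; have E := Z 0 _ (bounded_measurableX r 0); rewrite mul0r in E.
  by rewrite -[RHS]E; congr L; apply/funext => x; rewrite mul0r.
have Lsum (c : nat -> R) m : L1 (fun x => \sum_(i < m) c i * x ^+ i) =
    L2 (fun x => \sum_(i < m) c i * x ^+ i).
  elim: m => [|m IH].
    rewrite (_ : (fun x => _) = fun=> 0) ?L0//.
    by apply/funext => x; rewrite big_ord0.
  rewrite (_ : (fun x => _) = (fun x => \sum_(i < m) c i * x ^+ i + c m * x ^+ m)); last first.
    by apply/funext => x; rewrite big_ord_recr.
  have bX := bounded_measurableX r m.
  have bZ := bounded_measurableZ (c m) bX; have bS := bounded_measurable_sum r c m.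
  by rewrite D1// D2// Z1// Z2// IH L12.
apply/eqP; rewrite -subr_eq0 -normr_eq0; apply/eqP/le_anti; rewrite normr_ge0 andbT.
apply/ler_addgt0Pr => e e0; rewrite add0r.
have C0 : 0 < `|C1| + `|C2| + 1 by rewrite ltr_wpDl ?addr_ge0.
have [L LL Lf] := smooth_lipschitz sf r0.
(* Replacing f by f - p costs at most C1 + C2 times this tolerance; the absolute values and the 1
   keep the denominator positive. *)
have e'0 : 0 < e / (`|C1| + `|C2| + 1) by rewrite divr_gt0.
have [p hp] := lipschitz_poly_approx r0 LL e'0 Lf.
pose P x := \sum_(i < size p) p`_i * x ^+ i.
have bP : bounded_measurable r P := bounded_measurable_sum r (fun i => p`_i) (size p).
have PE x : p.[x] = P x by exact: horner_coef.
have bNP := bounded_measurableZ (-1) bP.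
have bd := bounded_measurableD bf bNP.
have hd x : `|x| <= r -> `|f x + -1 * P x| <= e / (`|C1| + `|C2| + 1).
  by move=> xr; rewrite mulN1r -PE hp.
have -> : L1 f - L2 f = L1 (fun x => f x + -1 * P x) - L2 (fun x => f x + -1 * P x).
  by rewrite D1// D2// Z1// Z2// (Lsum (fun i => p`_i)); ring.
rewrite (le_trans (ler_normB _ _))//.
rewrite (le_trans (lerD (B1 _ _ (ltW e'0) bd hd) (B2 _ _ (ltW e'0) bd hd)))//.
rewrite -mulrDl mulrA ler_pdivrMr// mulrC ler_wpM2l ?(ltW e0)//.
by rewrite (le_trans (lerD (ler_norm C1) (ler_norm C2)))// lerDl.
Qed.

End BernsteinApproximation.

(** * The simplex functional *)

Section SimplexFunctional.
Set Implicit Arguments.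
Unset Strict Implicit.
Import numFieldNormedType.Exports.
Local Open Scope classical_set_scope.
Local Opaque Gamma.

Lemma sum_simplex_pt (R : realType) (n : nat) (s : n.-tuple R) :
  \sum_p simplex_pt s p = 1.
Proof.
rewrite big_ord_recr/= {2}/simplex_pt ltnn [X in X + _](_ : _ = \sum_(i < n) tnth s i).
  by rewrite addrC subrK.
by apply: eq_bigr => i _; rewrite /simplex_pt/= ltn_ord (tnth_nth 0).
Qed.

Lemma measurable_simplex_pt (R : realType) (n : nat) (p : 'I_n.+1) :
  measurable_fun [set: n.-tuple R] (fun s => simplex_pt s p).
Proof.
rewrite /simplex_pt; have [pn|_] := ltnP p n.
  rewrite (_ : (fun s => _) = (fun s : n.-tuple R => tnth s (Ordinal pn))).
    exact: measurable_tnth.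
  by apply/funext => s; rewrite (tnth_nth 0).
apply: measurable_funB => //; apply: measurable_sum => i.
exact: measurable_tnth.
Qed.

Definition simplex_weight (R : realType) (n : nat) (a : 'I_n.+1 -> R) (s : n.-tuple R) : R :=
  \prod_p pw (a p) (simplex_pt s p).

Lemma simplex_weight_dirichlet (R : realType) (n : nat) (a : 'I_n.+1 -> R) (s : n.-tuple R) :
  simplex_weight a s = dirichlet_weight (fun i => a (inord i)) 1 s.
Proof.
rewrite /simplex_weight /dirichlet_weight big_ord_recr/=; congr (_ * _).
  apply: eq_bigr => i _; rewrite /simplex_pt /= ltn_ord (tnth_nth 0).
  by congr (pw (a _) _); apply/val_inj; rewrite /= inordK// ltnS ltnW.
rewrite /simplex_pt /= ltnn; congr (pw (a _) _).
by apply/val_inj; rewrite /= inordK.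
Qed.

Lemma simplex_weight_ge0 (R : realType) (n : nat) (a : 'I_n.+1 -> R) (s : n.-tuple R) :
  0 <= simplex_weight a s.
Proof. by rewrite prodr_ge0// => p _; exact: pw_ge0. Qed.

Lemma measurable_simplex_weight (R : realType) (n : nat) (a : 'I_n.+1 -> R) :
  measurable_fun [set: n.-tuple R] (simplex_weight a).
Proof.
rewrite (_ : simplex_weight a = dirichlet_weight (fun i => a (inord i)) 1).
  exact: measurable_dirichlet_weight.
by apply/funext => s; exact: simplex_weight_dirichlet.
Qed.

Lemma iint_simplex_weight (R : realType) (n : nat) (a : 'I_n.+1 -> R) :
  (forall p, 0 < a p) ->
  iint (fun s : n.-tuple R => (simplex_weight a s)%:E) = (dirichlet_mass a)%:E.
Proof.
move=> a0; under eq_iint do rewrite simplex_weight_dirichlet.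
rewrite iint_dirichlet_weight//.
rewrite {1}/pw ler01 powR1 mul1r /dirichlet_mass.
have Ea : \sum_(i < n.+1) a (inord i) = \sum_p a p.
  by apply: eq_bigr => i _; rewrite inord_val.
have Eg : \prod_(i < n.+1) Gamma (a (inord i)) = \prod_p Gamma (a p).
  by apply: eq_bigr => i _; rewrite inord_val.
by rewrite Ea Eg.
Qed.

Definition simplex_integrand (R : realType) (n : nat) (l : 'I_n.+1 -> R)
    (a : 'I_n.+1 -> R) (f : R -> R) (s : n.-tuple R) : R :=
  f (\sum_p l p * simplex_pt s p) * simplex_weight a s.

Lemma simplex_weight_neq0 (R : realType) (n : nat) (a : 'I_n.+1 -> R) (s : n.-tuple R) :
  simplex_weight a s != 0 -> forall p, 0 <= simplex_pt s p.
Proof.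
move=> W0 p; rewrite leNgt; apply: contra W0 => p0.
by rewrite /simplex_weight (bigD1 p)//= pw_lt0// mul0r.
Qed.

Lemma simplex_combination_le (R : realType) (n : nat) (l : 'I_n.+1 -> R) (s : n.-tuple R) :
  (forall p, 0 <= simplex_pt s p) ->
  `|\sum_p l p * simplex_pt s p| <= \sum_p `|l p|.
Proof.
move=> s0; rewrite (le_trans (ler_norm_sum _ _ _))// ler_sum// => p _.
rewrite normrM (ger0_norm (s0 p)) ler_piMr// -(sum_simplex_pt s) (bigD1 p)//= lerDl.
by rewrite sumr_ge0.
Qed.

Lemma measurable_simplex_integrand (R : realType) (n : nat) (l a : 'I_n.+1 -> R)
    (f : R -> R) : measurable_fun [set: R] f ->
  measurable_fun [set: n.-tuple R] (simplex_integrand l a f).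
Proof.
move=> mf; apply: measurable_funM; last exact: measurable_simplex_weight.
apply: (measurableT_comp mf); apply: measurable_sum => p.
by apply: measurable_funM => //; exact: measurable_simplex_pt.
Qed.

(** On the simplex |l . t| is at most \sum_p |l_p|, so the bound on [f] applies; off the simplex [f]
    is uncontrolled but the weight is 0. *)
Lemma iint_abs_simplex_integrand_le (R : realType) (n : nat) (l a : 'I_n.+1 -> R)
    (f : R -> R) (r M : R) : (forall p, 0 < a p) -> \sum_p `|l p| <= r ->
  measurable_fun [set: R] f -> 0 <= M -> (forall x, `|x| <= r -> `|f x| <= M) ->
  (iint (fun s => `|(simplex_integrand l a f s)%:E|) <= (M * dirichlet_mass a)%:E)%E.
Proof.
move=> a0 lr mf M0 fM.
have mG := measurable_simplex_integrand l a mf.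
have mW := measurable_simplex_weight a.
rewrite EFinM -iint_simplex_weight// -ge0_iintZ//; last 2 first.
- exact/measurable_EFinP.
- by move=> s; rewrite lee_fin simplex_weight_ge0.
apply: ge0_le_iint => //.
- by apply: measurableT_comp => //; exact/measurable_EFinP.
- by apply: measurable_funeM; exact/measurable_EFinP.
move=> s; rewrite /= -EFinM lee_fin /simplex_integrand normrM.
rewrite (ger0_norm (simplex_weight_ge0 _ _)).
have [->|W0] := eqVneq (simplex_weight a s) 0; first by rewrite !mulr0.
rewrite ler_wpM2r ?simplex_weight_ge0// fM// (le_trans _ lr)//.
by apply: simplex_combination_le; exact: simplex_weight_neq0 W0.
Qed.

Lemma iint_abs_simplex_integrand_lty (R : realType) (n : nat) (l a : 'I_n.+1 -> R)
    (f : R -> R) (r : R) : (forall p, 0 < a p) -> \sum_p `|l p| <= r ->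
  bounded_measurable r f -> (iint (fun s => `|(simplex_integrand l a f s)%:E|) < +oo)%E.
Proof.
move=> a0 lr [mf [M fM]].
apply: le_lt_trans (iint_abs_simplex_integrand_le (M := `|M|) a0 lr mf _ _) _ => //.
  by move=> x xr; rewrite (le_trans (fM x xr))// ler_norm.
exact: ltry.
Qed.

(** Finiteness and additivity are proved together because splitting off one term needs the absolute
    finiteness of the remaining sum. *)
Lemma iint_sum (R : realType) (m : nat) (I : Type) (s : seq I) (g : I -> m.-tuple R -> R) :
  (forall i, measurable_fun setT (g i)) ->
  (forall i, (iint (fun t => `|(g i t)%:E|) < +oo)%E) ->
  (iint (fun t => `|(\sum_(i <- s) g i t)%:E|) < +oo)%E /\
  (iint (fun t => (\sum_(i <- s) g i t)%:E) = \sum_(i <- s) iint (fun t => (g i t)%:E))%E.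
Proof.
move=> mg fg; elim: s => [|i s [IH1 IH2]].
  have z : iint (fun t : m.-tuple R => 0%:E) = 0%E.
    by elim: (m) => [//|k /= IH]; rewrite integral0_eq.
  split; last by under eq_iint do rewrite big_nil; rewrite big_nil.
  by under eq_iint do rewrite big_nil abse0; rewrite z.
have ms : measurable_fun setT (fun t => \sum_(j <- s) g j t) by exact: measurable_sum.
split; last first.
  under eq_iint do rewrite big_cons.
  by rewrite iintD// IH2 big_cons.
apply: (@le_lt_trans _ _ (iint (fun t => (`|g i t| + `|\sum_(j <- s) g j t|)%:E))%E).
  apply: ge0_le_iint => //.
  - apply: measurableT_comp => //; apply/measurable_EFinP; exact: measurable_sum.
  - by apply/measurable_EFinP/measurable_funD; exact: measurableT_comp.
  - by move=> t; rewrite big_cons lee_fin ler_normD.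
rewrite iintD//; try exact: measurableT_comp.
- exact: lte_add_pinfty (fg i) IH1.
- by under eq_iint do rewrite /= normr_id; exact: fg.
- by under eq_iint do rewrite /= normr_id; exact: IH1.
Qed.

Lemma simplex_integrand_mulX (R : realType) (n : nat) (l a : 'I_n.+1 -> R) (m : nat)
    (s : n.-tuple R) : (forall p, 0 < a p) ->
  simplex_integrand l a (fun x => x ^+ m.+1) s =
  \sum_p l p * simplex_integrand l (shift_at a p) (fun x => x ^+ m) s.
Proof.
move=> a0; rewrite /simplex_integrand exprS -mulrA mulr_suml; apply: eq_bigr => p _.
rewrite -mulrA; congr (_ * _); rewrite mulrCA; congr (_ * _).
rewrite /simplex_weight [in LHS](bigD1 p)//= [RHS](bigD1 p)//= mulrA mul_pw//.
rewrite /shift_at eqxx; congr (_ * _).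
by apply: eq_bigr => i /negbTE ->; rewrite addr0.
Qed.



Lemma iint_simplex_moment (R : realType) (n : nat) (l a : 'I_n.+1 -> R) (m : nat) :
  (forall p, 0 < a p) ->
  iint (fun s : n.-tuple R => (simplex_integrand l a (fun x => x ^+ m) s)%:E) =
  (dirichlet_moment l m a)%:E.
Proof.
elim: m a => [|m IH] a a0.
  rewrite -iint_simplex_weight//; apply: eq_iint => s.
  by rewrite /simplex_integrand expr0 mul1r.
have mG p := measurable_simplex_integrand l (shift_at a p) (measurable_funX m (@measurable_id _ _ [set: R])).
have fG p : (iint (fun s : n.-tuple R => `|(simplex_integrand l (shift_at a p) (fun x => x ^+ m) s)%:E|) < +oo)%E.
  apply: (iint_abs_simplex_integrand_lty (r := \sum_p `|l p|)) => //.
    exact: shift_at_gt0.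
  exact: bounded_measurableX.
have ZG p : iint (fun s : n.-tuple R => (l p * simplex_integrand l (shift_at a p) (fun x => x ^+ m) s)%:E) =
    (l p * dirichlet_moment l m (shift_at a p))%:E.
  by rewrite iintZ// IH ?EFinM//; exact: shift_at_gt0.
under eq_iint do rewrite simplex_integrand_mulX//.
rewrite (iint_sum _ _ _).2.
- by rewrite /= -sumEFin; apply: eq_bigr => p _; exact: ZG.
- by move=> p; apply: measurable_funM => //; exact: mG.
- move=> p; rewrite (eq_iint (h := fun s : n.-tuple R => (`|l p|)%:E *
    `|(simplex_integrand l (shift_at a p) (fun x => x ^+ m) s)%:E|)%E); last first.
    by move=> s; rewrite -abse_EFin -abseM.
  rewrite ge0_iintZ//; last by apply/measurable_EFinP; exact: measurableT_comp.
  by rewrite lte_mul_pinfty// lee_fin.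
Qed.

(** The integrands agree pointwise: off the closed simplex some [pw] factor vanishes, and on it the
    factor t_j is absorbed into the j-th exponent. *)
Lemma simplex_integralE (R : realType) (n : nat) (k : R) (j : 'I_n.+1) (l : 'I_n.+1 -> R)
    (f : R -> R) : 0 < k ->
  simplex_integral (fun t => f (\sum_p l p * t p) * t j * powR (\prod_p t p) (k - 1)) =
  iint (fun s : n.-tuple R => (simplex_integrand l (shift_at (fun=> k) j) f s)%:E).
Proof.
move=> k0; apply: eq_iint => s; case: ifPn => [/forallP s0|]; last first.
  rewrite negb_forall => /existsP[p]; rewrite -ltNge => p0.
  rewrite /simplex_integrand; set w := simplex_weight _ s.
  have [->|w0] := eqVneq w 0; first by rewrite mulr0.
  by have := simplex_weight_neq0 w0 p; rewrite leNgt p0.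
congr (_%:E); rewrite /simplex_integrand -mulrA; congr (_ * _).
have -> : (\prod_p simplex_pt s p) `^ (k - 1) = \prod_p pw k (simplex_pt s p).
  transitivity (\prod_p (simplex_pt s p) `^ (k - 1)).
    have [H _] : (\prod_p simplex_pt s p) `^ (k - 1) = \prod_p (simplex_pt s p) `^ (k - 1)
        /\ 0 <= \prod_p simplex_pt s p.
      (* Nonnegativity of the partial products is carried along because [powRM] needs it. *)
      apply: (big_ind2 (fun x y => x `^ (k - 1) = y /\ 0 <= x)).
      - by rewrite powR1.
      - by move=> x1 x2 y1 y2 [<- x10] [<- y10]; rewrite powRM// mulr_ge0.
      - by move=> p _.
    exact: H.
  by apply: eq_bigr => p _; rewrite /pw s0.
rewrite /simplex_weight (bigD1 j)//= [RHS](bigD1 j)//= mulrA mul_pw// /shift_at eqxx.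
by congr (_ * _); apply: eq_bigr => p /negbTE ->; rewrite addr0.
Qed.

Lemma local_functional_simplex (R : realType) (n : nat) (l a : 'I_n.+1 -> R) (c r : R) :
  (forall p, 0 < a p) -> \sum_p `|l p| <= r ->
  local_functional r (`|c| * dirichlet_mass a) (fun f =>
    c * fine (iint (fun s : n.-tuple R => (simplex_integrand l a f s)%:E))).
Proof.
move=> a0 lr.
have fin f : bounded_measurable r f ->
    iint (fun s : n.-tuple R => (simplex_integrand l a f s)%:E) \is a fin_num.
  move=> bf; rewrite fin_num_abs; apply: le_lt_trans (iint_abs_simplex_integrand_lty a0 lr bf).
  apply: le_abse_iint; apply/measurable_EFinP.
  exact: (measurable_simplex_integrand l a (proj1 bf)).
have lty f := @iint_abs_simplex_integrand_lty R n l a f r a0 lr.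
have mG f (bf : bounded_measurable r f) := measurable_simplex_integrand l a (proj1 bf).
split=> [f g bf bg|d f bf|e f e0 bf fe].
- rewrite -mulrDr -fineD ?fin// -iintD;
    [|exact: mG bf|exact: mG bg|exact: lty bf|exact: lty bg].
  congr (_ * fine _); by apply: eq_iint => s; rewrite /simplex_integrand mulrDl.
- rewrite mulrCA; congr (_ * _).
  have -> : d * fine (iint (fun s : n.-tuple R => (simplex_integrand l a f s)%:E)) =
      fine (d%:E * iint (fun s : n.-tuple R => (simplex_integrand l a f s)%:E)).
    by rewrite fineM// fin.
  rewrite -iintZ; [|exact: mG bf|exact: lty bf].
  congr (fine _); by apply: eq_iint => s; rewrite /simplex_integrand mulrA.
- rewrite normrM -mulrA ler_wpM2l// mulrC -lee_fin -abse_EFin fineK ?fin//.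
  apply: le_trans (iint_abs_simplex_integrand_le a0 lr (proj1 bf) e0 fe).
  by apply: le_abse_iint; apply/measurable_EFinP; exact: mG.
Qed.

End SimplexFunctional.

(** * Moments of the representing measures *)

Section IntertwiningMeasures.
Set Implicit Arguments.
Unset Strict Implicit.
Import numFieldNormedType.Exports.
Import -(notations) mpoly.
Local Open Scope classical_set_scope.
Local Opaque Gamma.

Lemma measurable_coord_gt (R : realType) (N : nat) (r : R) :
  measurable [set x : N.-tuple R | exists i, r < `|tnth x i|].
Proof.
rewrite (_ : [set _ | _] = \bigcup_(i in [set: 'I_N]) [set x : N.-tuple R | r < `|tnth x i|]).
  apply: fin_bigcup_measurable => // i _.
  rewrite (_ : [set _ | _] = (fun x : N.-tuple R => `|tnth x i|) @^-1` `]r, +oo[).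
    rewrite -[X in measurable X]setTI.
    have mf : measurable_fun [set: N.-tuple R] (fun x : N.-tuple R => `|tnth x i|).
      by apply: measurableT_comp => //; exact: measurable_tnth.
    exact: mf.
  by apply/seteqP; split=> x /=; rewrite in_itv/= andbT.
by apply/seteqP; split=> [x [i xi]|x [i _ xi]]; exists i.
Qed.

Lemma local_functional_probability (R : realType) (N : nat)
    (P : probability (N.-tuple R) R) (j : 'I_N) (r : R) :
  P [set x | exists i, r < `|tnth x i|] = 0%E ->
  (forall f, bounded_measurable r f -> P.-integrable setT (fun x => (f (tnth x j))%:E)) /\
  local_functional r 1 (fun f => fine (\int[P]_x (f (tnth x j))%:E)).
Proof.
move=> P0.
have mc f : bounded_measurable r f ->
    measurable_fun [set: N.-tuple R] (fun x => (f (tnth x j))%:E).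
  by case=> mf _; apply/measurable_EFinP; exact: (measurableT_comp mf (measurable_tnth j)).
have bd f (M : R) : bounded_measurable r f -> 0 <= M -> (forall x, `|x| <= r -> `|f x| <= M) ->
    (\int[P]_x `|(f (tnth x j))%:E| <= M%:E)%E.
  move=> bf M0 fM.
  apply: (@le_trans _ _ (\int[P]_x (cst M%:E x))%E); last first.
    by rewrite integral_cst//= [X in (_ * X)%E](probability_setT P) mule1.
  apply: ae_ge0_le_integral => //.
  - by apply: measurableT_comp => //; exact: mc.
  exists [set x | exists i, r < `|tnth x i|]; split => //; first exact: measurable_coord_gt.
  move=> x /= nx; apply: contrapT => xr; apply: nx => _.
  rewrite lee_fin fM// leNgt; apply/negP => jr; apply: xr.
  by exists j.
have int f : bounded_measurable r f -> P.-integrable setT (fun x => (f (tnth x j))%:E).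
  move=> bf; apply/integrableP; split; first exact: mc.
  case: (bf) => _ [M fM]; apply: le_lt_trans (bd f `|M| bf _ _) (ltry _) => // x xr.
  by rewrite (le_trans (fM x xr))// ler_norm.
split=> //; split=> [f g bf bg|c f bf|e f e0 bf fe].
- rewrite -fineD ?integrable_fin_num//; try exact: int.
  by rewrite -integralD//; exact: int.
- have fin : (\int[P]_x (f (tnth x j))%:E)%E \is a fin_num by apply: integrable_fin_num => //; exact: int.
  rewrite (_ : c * _ = fine (c%:E * \int[P]_x (f (tnth x j))%:E)%E); last by rewrite fineM.
  by rewrite -integralZl//; exact: int.
- have fin : (\int[P]_x (f (tnth x j))%:E)%E \is a fin_num by apply: integrable_fin_num => //; exact: int.
  rewrite mul1r -lee_fin -abse_EFin fineK//.
  apply: le_trans (bd f e bf e0 fe).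
  by apply: le_abse_integral => //; exact: mc.
Qed.

(** The factor n + 1 of [c_nk] is the ratio (n + 1) k / k from [dirichlet_mass_shift] at constant
    exponents. *)
Lemma c_nk_mass (R : realType) (n : nat) (k : R) (j : 'I_n.+1) : 0 < k ->
  c_nk n k * dirichlet_mass (shift_at (fun=> k) j) = 1.
Proof.
move=> k0; have a0 (p : 'I_n.+1) : 0 < (fun=> k : R) p by [].
have := dirichlet_mass_shift j a0; rewrite /dirichlet_mass prodr_const sumr_const card_ord.
rewrite -mulr_natl -/(dirichlet_mass _) /c_nk.
have N0 : 0 < n.+1%:R :> R by rewrite ltr0n.
have Gk : Gamma k ^+ n.+1 != 0 by rewrite expf_neq0// gt_eqF// Gamma_gt0.
have GN : Gamma (n.+1%:R * k) != 0 by rewrite gt_eqF// Gamma_gt0// mulr_gt0.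
move: (dirichlet_mass _) (Gamma _) GN (_ ^+ _) Gk => D G G0 g g0 E.
have -> : D = k * (g / G) / (n.+1%:R * k).
  by rewrite -E mulrAC divff ?mul1r// mulf_neq0// gt_eqF.
by field; rewrite g0 G0 !gt_eqF.
Qed.

Lemma sum2_subZ (R : realType) (I : finType) (F G : I -> I -> R) (c : R) :
  \sum_i \sum_p (F i p - c * G i p) =
  \sum_i \sum_p F i p - c * \sum_i \sum_p G i p.
Proof.
rewrite mulr_sumr -sumrB; apply: eq_bigr => i _.
by rewrite mulr_sumr -sumrB.
Qed.

(** Since x_j^(m+1) has a single nonzero partial derivative, a multiple of x_j^m, the induction
    hypothesis gives every T_i q explicitly. Degree 0 is settled by normalisation, as the maximum
    principle needs positive degree. *)
Lemma Vk_moment (R : realType) (n : nat) (k : R)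
    (mu : (n.+1).-tuple R -> probability ((n.+1).-tuple R) R) (j : 'I_n.+1) (m : nat)
    (l : (n.+1).-tuple R) : 0 < k -> Vk_measures k mu ->
  (\int[mu l]_x (tnth x j ^+ m)%:E =
   (c_nk n k * dirichlet_moment (tnth l) m (shift_at (fun=> k) j))%:E)%E.
Proof.
move=> k0 [supp [hom inter]]; set c := c_nk n k.
elim: m l => [|m IH] l.
  under eq_integral do rewrite expr0.
  by rewrite integral_cst//= [X in (_ * X)%E](probability_setT (mu l)) mule1 c_nk_mass.
pose p : mpoly.mpoly n.+1 R := mpolyX R (mnm_muln (mnm1 j) m.+1).
have pE v : mpoly.meval v p = v j ^+ m.+1.
  by rewrite /p -mpolyXn rmorphXn/= mevalXU.
have hp : homog_deg m.+1 p by rewrite /homog_deg /p msuppX/= mdegMn mdeg1 mul1n eqxx.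
have [q [hq qE]] := hom _ _ hp.
have derp i v : mpoly.meval v (mpoly.mderiv i p) = (i == j)%:R * m.+1%:R * v j ^+ m.
  rewrite /p mderivX mevalZ mulmnE mnm1E eq_sym.
  have [->|_] := eqVneq i j; last by rewrite mul0n !mul0r.
  rewrite mul1n mul1r; congr (_ * _).
  rewrite (_ : mnm_sub _ _ = mnm_muln (mnm1 j) m); last by rewrite mulmS addmC addmK.
  by rewrite -mpolyXn rmorphXn/= mevalXU.
have int_p (l' : (n.+1).-tuple R) : (\int[mu l']_x (mpoly.meval (tnth x) p)%:E =
    \int[mu l']_x (tnth x j ^+ m.+1)%:E)%E.
  by apply: eq_integral => x _; rewrite pE.
have intX (l' : (n.+1).-tuple R) : (mu l').-integrable setT (fun x => (tnth x j ^+ m)%:E).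
  have [r hr] := supp l'.
  by apply: (local_functional_probability j hr).1 (bounded_measurableX r m).
have dunklE v i : injective v ->
    dunkl k i q v = (i == j)%:R * m.+1%:R * (c * dirichlet_moment v m (shift_at (fun=> k) j)).
  (* The measures are indexed by tuples, while orbits consist of functions; [v] is re-encoded as a
     tuple. *)
  move=> vinj; have vE : tnth [tuple v i | i < n.+1] = v by apply/funext => ?; rewrite tnth_mktuple.
  have := inter p q qE i [tuple v i | i < n.+1]; rewrite vE => /(_ vinj).
  under eq_integral do rewrite derp EFinM.
  set t := [tuple v i | i < n.+1]; set A := _ * m.+1%:R.
  have Z : (\int[mu t]_x (A%:E * (tnth x j ^+ m)%:E) =
      A%:E * \int[mu t]_x (tnth x j ^+ m)%:E)%E := integralZl measurableT (intX t) A.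
  by rewrite Z IH vE -EFinM => -[].
pose M v := dirichlet_moment v m.+1 (shift_at (fun=> k) j).
have q_inj v : injective v -> mpoly.meval v q = c * M v.
  move=> vinj; apply/eqP; rewrite -subr_eq0; apply/eqP; move: v vinj.
  (* The difference solves the homogeneous equation: the right-hand sides of the two recursions
     cancel after scaling one by [c]. *)
  apply: (dunkl_maximum_principle k0 (ltn0Sn m) (d := fun v => mpoly.meval v q - c * M v)).
  move=> v vinj; have E2 := sum_dunkl_euler k hq vinj.
  rewrite (bigD1 j)//= big1 ?addr0 in E2; last first.
    by move=> i /negbTE ij; rewrite dunklE// ij !mul0r mulr0.
  rewrite dunklE// eqxx mul1r in E2.
  have E1 : m.+1%:R * M v + k / 2 * \sum_i \sum_p (M v - M (swap_pt i p v)) =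
      m.+1%:R * v j * dirichlet_moment v m (shift_at (fun=> k) j)
    := dirichlet_moment_dunkl_euler v m.+1 j k0.
  have -> : \sum_i \sum_p0 (mpoly.meval v q - c * M v -
        (mpoly.meval (swap_pt i p0 v) q - c * M (swap_pt i p0 v))) =
      \sum_i \sum_p0 (mpoly.meval v q - mpoly.meval (swap_pt i p0 v) q) -
      c * \sum_i \sum_p0 (M v - M (swap_pt i p0 v)).
    rewrite -sum2_subZ; apply: eq_bigr => i _; apply: eq_bigr => p0 _.
    by move: (M v) (M _) => x y; ring.
  set A := \sum_i \sum_p (M v - M (swap_pt i p v)) in E1 *.
  set B := \sum_i \sum_p (mpoly.meval v q - mpoly.meval (swap_pt i p v) q) in E2 *.
  move: A B (M v) E1 E2 => A B x E1 E2.
  have -> : m.+1%:R * (mpoly.meval v q - c * x) + k / 2 * (B - c * A) =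
    (m.+1%:R * mpoly.meval v q + k / 2 * B) - c * (m.+1%:R * x + k / 2 * A) by ring.
  by rewrite -E2 E1; ring.
have [P hP] := dirichlet_moment_mpoly m.+1 (shift_at (fun=> k) j).
have q_all v : mpoly.meval v (q - c *: P) = 0.
  apply: meval_eq0_off_diagonals => w winj.
  by rewrite mevalB mevalZ hP q_inj// subrr.
rewrite -int_p qE -hP; congr (_%:E); apply/eqP; rewrite -subr_eq0.
by rewrite -mevalZ -mevalB q_all.
Qed.

End IntertwiningMeasures.

Theorem theorem4p6 (R : realType) (n : nat) (k : R) (j : 'I_n.+1) (f : R -> R)
    (mu : (n.+1).-tuple R -> probability ((n.+1).-tuple R) R) :
  (1 <= n)%N -> 0 < k -> smooth f -> Vk_measures k mu ->
  forall l : (n.+1).-tuple R,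
    (\int[mu l]_x (f (tnth x j))%:E
     = (c_nk n k)%:E *
       simplex_integral (fun t : 'I_n.+1 -> R =>
         (f (\sum_(p < n.+1) tnth l p * t p) * t j
           * powR (\prod_(p < n.+1) t p) (k - 1))%R))%E.
Proof.
move=> _ k0 sf Vk l; have [r0 hr0] := proj1 Vk l.
(* One radius serves both functionals: it dominates the support of [mu l] in every coordinate and
   the values l . t on the simplex, and the 1 makes it positive. *)
pose r := Num.max (Num.max r0 (\sum_p `|tnth l p|)) 1.
have r_gt0 : 0 < r by rewrite lt_max ltr01 orbT.
have lr : \sum_p `|tnth l p| <= r by rewrite !le_max lexx orbT.
have a0 p : 0 < shift_at (fun=> k) j p by exact: shift_at_gt0.
have hr : mu l (fun x => exists i, r < `|tnth x i|) = 0%E.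
  apply: (subset_measure0 _ _ _ hr0); [exact: measurable_coord_gt..|].
  by move=> x [i xi]; exists i; apply: le_lt_trans xi; rewrite !le_max lexx.
have [int L1] := local_functional_probability j hr.
have L2 := local_functional_simplex (c_nk n k) a0 lr.
have bf := smooth_bounded_measurable r_gt0 sf.
have fin : (\int[mu l]_x (f (tnth x j))%:E)%E \is a fin_num.
  by apply: integrable_fin_num => //; exact: int.
have := eq_local_functional r_gt0 L1 L2 _ sf => /(_ _)/= E.
rewrite simplex_integralE//.
have fin2 : iint (fun s : n.-tuple R => (simplex_integrand (tnth l) (shift_at (fun=> k) j) f s)%:E)
    \is a fin_num.
  rewrite fin_num_abs; apply: le_lt_trans (iint_abs_simplex_integrand_lty a0 lr bf).
  apply: le_abse_iint; apply/measurable_EFinP.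
  exact: (measurable_simplex_integrand (tnth l) _ (proj1 bf)).
rewrite -(fineK fin) -(fineK fin2) -EFinM; congr (_%:E); apply: E => m.
by rewrite (Vk_moment j m l k0 Vk) iint_simplex_moment.
Qed.
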